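(* The restless multi-armed bandit with global rewards problem (RMAB-G) is PSPACE-hard.
   Context: An RMAB-G instance consists of $N$ arms, a budget $K$, and for each arm $i$ a tuple $(\mathcal{S},\mathcal{A},R_i,R_{\mathrm{glob}},P_i,\gamma)$. Here $\mathcal{S}$ is a finite state space, $\mathcal{A}=\{0,1\}$ is the action space (0 = not pulling, 1 = pulling), $R_i:\mathcal{S}\times\mathcal{A}\to\mathbb{R}$ is a per-arm reward, $P_i:\mathcal{S}\times\mathcal{A}\times\mathcal{S}\to[0,1]$ is a transition function ($P_i(s,a,s')$ is the probability that arm $i$ moves from $s$ to $s'$ under action $a$; arms transition independently given the states and actions), $\gamma\in[0,1)$ is a discount factor, and $R_{\mathrm{glob}}:\mathcal{S}^N\times\mathcal{A}^N\to\mathbb{R}$ is a global reward. For each fixed $\mathbf{s}$, $R_{\mathrm{glob}}(\mathbf{s},\mathbf{a})$ is a monotone submodular set function of $\{i: a_i=1\}$. The problem is to find a policy $\pi:\mathcal{S}^N\to\mathcal{A}^N$ pulling at most $K$ arms in each time step ($\sum_i a_i^{(t)}\le K$ for all $t$) that maximizes $$\mathbb{E}_{(\mathbf{s},\mathbf{a})\sim(P,\pi)}\Big[\sum_{t=0}^{\infty}\gamma^t\Big(R_{\mathrm{glob}}(\mathbf{s}^{(t)},\mathbf{a}^{(t)})+\sum_{i=1}^N R_i(s_i^{(t)},a_i^{(t)})\Big)\Big].$$ *)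

(* Defs.v *)
From Corelib Require Import BinNums.
From HB Require Import structures.
From mathcomp Require Import all_boot all_order all_algebra.
From mathcomp Require Import all_classical all_reals all_analysis.

Set Implicit Arguments.
Unset Strict Implicit.
Unset Printing Implicit Defensive.

Import Order.TTheory GRing.Theory Num.Theory.
Import numFieldNormedType.Exports.

Local Open Scope ring_scope.

Definition bitstring := seq bool.

Definition language := bitstring -> Prop.

Inductive move := MoveLeft | MoveRight | Stay.

(* Deterministic machines with [extra_tapes + 1] one-sided tapes.  Tape symbols
   are [None] (the blank), [Some (inl b)] (an input/output bit) and
   [Some (inr g)] (a work symbol).  [verdict q = None] means that [q] is not a
   halting state; in a halting state the boolean is the accept/reject answer,
   which is irrelevant when the machine is used to compute a function. *)
Record machine := Machine {
  extra_tapes : nat;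
  control : finType;
  work_symbol : finType;
  start : control;
  verdict : control -> option bool;
  transition :
    control -> {ffun 'I_extra_tapes.+1 -> option (bool + work_symbol)} ->
    control * ('I_extra_tapes.+1 -> option (bool + work_symbol) * move)
}.

Section Machine.
Variable M : machine.

Definition symbol := option (bool + work_symbol M).

Definition tape_index := 'I_(extra_tapes M).+1.

Record config := Config {
  state : control M;
  head : tape_index -> nat;
  cell : tape_index -> nat -> symbol
}.

(* Moving left from the leftmost cell leaves the head in place. *)
Definition move_head (m : move) (p : nat) : nat :=
  match m with MoveLeft => p.-1 | MoveRight => p.+1 | Stay => p end.

Definition step (c : config) : config :=
  if verdict (state c) is Some _ then c else
  let qa := transition (state c) [ffun j => cell c j (head c j)] in
  Config qa.1
    (fun j => move_head (qa.2 j).2 (head c j))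
    (fun j p => if p == head c j then (qa.2 j).1 else cell c j p).

Definition written (x : bitstring) (p : nat) : symbol :=
  nth None [seq Some (inl b) | b <- x] p.

Definition initial_config (x : bitstring) : config :=
  Config (start M) (fun=> 0%N)
    (fun j p => if j == ord0 then written x p else None).

Definition run (x : bitstring) (t : nat) : config :=
  iter t step (initial_config x).

Definition decides (L : language) : Prop :=
  forall x, exists t b,
    verdict (state (run x t)) = Some b /\ (b = true <-> L x).

Definition runs_in_space (sp : nat -> nat) : Prop :=
  forall x t j, (head (run x t) j < sp (size x))%N.

(* The result is read on the last tape, from its leftmost cell; halting
   configurations are fixed points of [step]. *)
Definition computes_in_time (f : bitstring -> bitstring) (tm : nat -> nat)
    : Prop :=
  forall x, let c := run x (tm (size x)) in
    verdict (state c) <> None /\ forall p, cell c ord_max p = written (f x) p.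

End Machine.

Definition poly_bounded (f : nat -> nat) : Prop :=
  exists c d : nat, forall n : nat, (f n <= c * n ^ d + c)%N.

Definition PSPACE (L : language) : Prop :=
  exists (M : machine) (sp : nat -> nat),
    [/\ poly_bounded sp, runs_in_space M sp & decides M L].

Definition polytime (f : bitstring -> bitstring) : Prop :=
  exists (M : machine) (tm : nat -> nat),
    poly_bounded tm /\ computes_in_time M f tm.

(* Decision problems given by abstract instances and an encoding; only the
   codes of legal instances are inputs of the problem. *)
Record decision_problem := DecisionProblem {
  instance : Type;
  encode : instance -> bitstring;
  encode_inj : injective encode;
  legal : instance -> Prop;
  yes : instance -> Prop
}.

(* Hardness under polynomial-time many-one reductions.  A reduction must
   always produce a legal instance, so that no hardness can come from the
   recognition of legal instances. *)
Definition PSPACE_hard (Pb : decision_problem) : Prop :=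
  forall L : language, PSPACE L ->
    exists r : bitstring -> instance Pb,
      polytime (fun x => encode (r x)) /\
      forall x, legal (r x) /\ (L x <-> yes (r x)).

Definition monotone_set_function (R : realType) (T : finType)
    (f : {set T} -> R) : Prop :=
  forall A B : {set T}, A \subset B -> f A <= f B.

Definition submodular (R : realType) (T : finType) (f : {set T} -> R) : Prop :=
  forall A B : {set T}, f (A :|: B) + f (A :&: B) <= f A + f B.

Definition joint_state (N : nat) (S : finType) := {ffun 'I_N -> S}.

(* [true] is the action "pull". *)
Definition joint_action (N : nat) := {ffun 'I_N -> bool}.

Definition pull (N : nat) (A : {set 'I_N}) : joint_action N :=
  [ffun i => i \in A].

Record rmabg (R : realType) (N : nat) (S : finType) := Rmabg {
  budget : nat;
  arm_reward : 'I_N -> S -> bool -> R;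
  global_reward : joint_state N S -> joint_action N -> R;
  arm_transition : 'I_N -> S -> bool -> S -> R;
  discount : R
}.

Section Rmabg.
Variables (R : realType) (N : nat) (S : finType) (B : rmabg R N S).

Definition stochastic : Prop :=
  forall i s a,
    (forall s', 0 <= arm_transition B i s a s') /\
    \sum_(s' : S) arm_transition B i s a s' = 1.

Definition well_formed : Prop :=
  [/\ (0 < N)%N,
      stochastic,
      0 <= discount B < 1 &
      forall s : joint_state N S,
        monotone_set_function (fun A => global_reward B s (pull A)) /\
        submodular (fun A => global_reward B s (pull A))].

Definition policy := joint_state N S -> joint_action N.

Definition within_budget (pi : policy) : Prop :=
  forall s, (\sum_(i < N) pi s i <= budget B)%N.

Definition reward (s : joint_state N S) (a : joint_action N) : R :=
  global_reward B s a + \sum_(i < N) arm_reward B i (s i) (a i).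

Definition joint_transition (s : joint_state N S) (a : joint_action N)
    (s' : joint_state N S) : R :=
  \prod_(i < N) arm_transition B i (s i) (a i) (s' i).

(* [X] is a state process of the bandit controlled by [pi] from [s0]:
   the coordinates are random variables and their joint law is the one of the
   Markov chain. Such a process always exists, and its law is unique. *)
Definition controlled_process (pi : policy) (s0 : joint_state N S)
    (d : measure_display) (Omega : measurableType d) (Pr : probability Omega R)
    (X : nat -> Omega -> joint_state N S) : Prop :=
  (forall t s, measurable [set w | X t w = s]%classic) /\
  (forall (t : nat) (h : nat -> joint_state N S),
     Pr [set w | forall k, (k <= t)%N -> X k w = h k]%classic =
     ((h 0%N == s0)%:R *
      \prod_(k < t) joint_transition (h k) (pi (h k)) (h k.+1))%:E).

Definition discounted_return (pi : policy) (h : nat -> joint_state N S) : R :=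
  limn (series (fun t => discount B ^+ t * reward (h t) (pi (h t)))).

Definition has_value (pi : policy) (s0 : joint_state N S) (v : \bar R) : Prop :=
  exists (d : measure_display) (Omega : measurableType d)
         (Pr : probability Omega R) (X : nat -> Omega -> joint_state N S),
    controlled_process pi s0 Pr X /\
    v = ('E_Pr[fun w => discounted_return pi (fun t => X t w)])%E.

End Rmabg.

(* A global reward is described by a Boolean circuit whose gates carry
   rational weights: its value is the sum of the weights of the gates that
   evaluate to true. Every rational-valued function of a joint state and a
   joint action is of this form, and a function whose values are computed in
   binary by a circuit has a description of about the size of this circuit.
   Gates are listed in topological order and gate references are relative:
   [k] is the gate placed [k + 1] positions earlier (and false if there is no
   such gate). *)
Inductive gate (N m : nat) :=
  | StateInput of 'I_N & 'I_m
  | ActionInput of 'I_N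
  | Const of bool
  | Not of nat
  | And of nat & nat
  | Or of nat & nat.

Section Circuit.
Variables (R : realType) (N m : nat).
Variables (s : joint_state N 'I_m) (a : joint_action N).

(* [vs] lists the values of the preceding gates, latest first. *)
Definition gate_value (vs : seq bool) (g : gate N m) : bool :=
  match g with
  | StateInput i x => s i == x
  | ActionInput i => a i
  | Const b => b
  | Not k => ~~ nth false vs k
  | And k l => nth false vs k && nth false vs l
  | Or k l => nth false vs k || nth false vs l
  end.

Fixpoint circuit_sum (vs : seq bool) (c : seq (gate N m * rat)) : R :=
  if c is (g, w) :: c' then
    let v := gate_value vs g in
    (if v then ratr w else 0) + circuit_sum (v :: vs) c'
  else 0.

Definition circuit_value (c : seq (gate N m * rat)) : R := circuit_sum [::] c.

End Circuit.

Record rmabg_data := RmabgData {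
  data_arms : nat;
  data_states : nat;
  data_budget : nat;
  data_reward : {ffun 'I_data_arms -> {ffun 'I_data_states ->
                  {ffun bool -> rat}}};
  data_global : seq (gate data_arms data_states * rat);
  data_transition : {ffun 'I_data_arms -> {ffun 'I_data_states ->
                      {ffun bool -> {ffun 'I_data_states -> rat}}}};
  data_discount : rat;
  data_init : {ffun 'I_data_arms -> 'I_data_states};
  data_threshold : rat
}.

Definition rmabg_of_data (R : realType) (D : rmabg_data) :
    rmabg R (data_arms D) 'I_(data_states D) :=
  Rmabg (data_budget D)
    (fun i s a => ratr (data_reward D i s a))
    (fun s a => circuit_value R s a (data_global D))
    (fun i s a s' => ratr (data_transition D i s a s'))
    (ratr (data_discount D)).

(* In codes of instances, tables are explicit, counts and indices are written
   in unary and rational numbers as pairs of binary integers. *)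

Definition prefix_injective (T : Type) (e : T -> bitstring) : Prop :=
  forall x y s t, e x ++ s = e y ++ t -> x = y /\ s = t.

Lemma prefix_injective_inj (T : Type) (e : T -> bitstring) :
  prefix_injective e -> injective e.
Proof. by move=> he x y exy; have [] := he x y [::] [::]; rewrite ?exy. Qed.

Lemma prefix_injective_cat (T : Type) (e : T -> bitstring) x y u v s t :
  prefix_injective e -> (e x ++ u) ++ s = (e y ++ v) ++ t ->
  x = y /\ u ++ s = v ++ t.
Proof. by move=> he; rewrite -!catA => /he. Qed.

Definition enc_unary (n : nat) : bitstring := rcons (nseq n true) false.

Lemma enc_unary_pinj : prefix_injective enc_unary.
Proof.
by elim=> [|n IH] [|k] s t //= => [[]|[] /IH[-> ->]].
Qed.

Definition enc_bool (b : bool) : bitstring := [:: b].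

Lemma enc_bool_pinj : prefix_injective enc_bool.
Proof. by move=> b c s t [-> ->]. Qed.

Definition enc_ord (n : nat) (i : 'I_n) : bitstring := enc_unary i.

Lemma enc_ord_pinj n : prefix_injective (@enc_ord n).
Proof. by move=> i j s t /enc_unary_pinj[/val_inj -> ->]. Qed.

Fixpoint enc_positive (p : positive) : bitstring :=
  match p with
  | xH => [:: false]
  | xO q => [:: true, false & enc_positive q]
  | xI q => [:: true, true & enc_positive q]
  end.

Lemma enc_positive_pinj : prefix_injective enc_positive.
Proof.
by elim=> [p IH|p IH|] [q|q|] s t //= => [[] /IH[-> ->]|[] /IH[-> ->]|[]].
Qed.

Definition enc_binary (n : nat) : bitstring :=
  if bin_of_nat n is Npos p then true :: enc_positive p else [:: false].

Lemma enc_binary_pinj : prefix_injective enc_binary.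
Proof.
move=> n k s t; rewrite /enc_binary => e.
suff [enk ->] : bin_of_nat n = bin_of_nat k /\ s = t.
  by rewrite (can_inj bin_of_natK enk).
case: (bin_of_nat n) (bin_of_nat k) e => [|p] [|q] //= []; first by [].
by move=> /enc_positive_pinj[-> ->].
Qed.

Definition enc_int (z : int) : bitstring := enc_bool (z < 0) ++ enc_binary `|z|.

Lemma enc_int_pinj : prefix_injective enc_int.
Proof.
move=> x y s t; rewrite /enc_int -!catA => /enc_bool_pinj[exy].
move=> /enc_binary_pinj[axy ->]; split=> //.
by rewrite [x]intEsign [y]intEsign exy axy.
Qed.

Definition enc_rat (q : rat) : bitstring := enc_int (numq q) ++ enc_int (denq q).

Lemma enc_rat_pinj : prefix_injective enc_rat.
Proof.
move=> x y s t; rewrite /enc_rat -!catA => /enc_int_pinj[nxy].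
move=> /enc_int_pinj[dxy ->]; split=> //.
by rewrite -[x]divq_num_den -[y]divq_num_den nxy dxy.
Qed.

Definition enc_seq (T : Type) (e : T -> bitstring) (l : seq T) : bitstring :=
  foldr (fun x w => true :: e x ++ w) [:: false] l.

Lemma enc_seq_pinj (T : Type) (e : T -> bitstring) :
  prefix_injective e -> prefix_injective (enc_seq e).
Proof.
move=> he; elim=> [|x l IH] [|y l'] s t //=; first by case=> ->.
by case; rewrite -!catA => /he[-> /IH[-> ->]].
Qed.

Definition enc_ffun (I : finType) (T : Type) (e : T -> bitstring)
    (f : {ffun I -> T}) : bitstring :=
  flatten [seq e (f i) | i <- enum I].

Lemma enc_ffun_pinj (I : finType) (T : Type) (e : T -> bitstring) :
  prefix_injective e -> prefix_injective (@enc_ffun I T e).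
Proof.
move=> he f g s t efg.
have [fg ->] : {in enum I, f =1 g} /\ s = t.
  move: efg; rewrite /enc_ffun; elim: (enum I) => [|i l IH] /= => [->//|].
  rewrite -!catA => /he[fgi /IH[fgl ->]]; split=> // j.
  by rewrite inE => /orP[/eqP->//|/fgl].
by split=> //; apply/ffunP => i; apply: fg; rewrite mem_enum.
Qed.

Definition enc_gate (N m : nat) (g : gate N m) : bitstring :=
  match g with
  | StateInput i x => enc_unary 0 ++ enc_ord i ++ enc_ord x
  | ActionInput i => enc_unary 1 ++ enc_ord i
  | Const b => enc_unary 2 ++ enc_bool b
  | Not k => enc_unary 3 ++ enc_unary k
  | And k l => enc_unary 4 ++ enc_unary k ++ enc_unary l
  | Or k l => enc_unary 5 ++ enc_unary k ++ enc_unary l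
  end.

Lemma enc_gate_pinj N m : prefix_injective (@enc_gate N m).
Proof.
move=> [i x|i|b|k|k l|k l] [i' x'|i'|b'|k'|k' l'|k' l'] s t;
  rewrite /enc_gate -!catA => /enc_unary_pinj[] // _.
- by move=> /enc_ord_pinj[-> /enc_ord_pinj[-> ->]].
- by move=> /enc_ord_pinj[-> ->].
- by move=> /enc_bool_pinj[-> ->].
- by move=> /enc_unary_pinj[-> ->].
- by move=> /enc_unary_pinj[-> /enc_unary_pinj[-> ->]].
- by move=> /enc_unary_pinj[-> /enc_unary_pinj[-> ->]].
Qed.

Definition enc_weighted_gate (N m : nat) (gw : gate N m * rat) : bitstring :=
  enc_gate gw.1 ++ enc_rat gw.2.

Lemma enc_weighted_gate_pinj N m : prefix_injective (@enc_weighted_gate N m).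
Proof.
move=> [g w] [g' w'] s t; rewrite /enc_weighted_gate /=.
by move=> /(prefix_injective_cat (@enc_gate_pinj _ _))[-> /enc_rat_pinj[-> ->]].
Qed.

Definition enc_rmabg (D : rmabg_data) : bitstring :=
  enc_unary (data_arms D) ++
  enc_unary (data_states D) ++
  enc_unary (data_budget D) ++
  enc_ffun (enc_ffun (enc_ffun enc_rat)) (data_reward D) ++
  enc_seq (@enc_weighted_gate _ _) (data_global D) ++
  enc_ffun (enc_ffun (enc_ffun (enc_ffun enc_rat))) (data_transition D) ++
  enc_rat (data_discount D) ++
  enc_ffun (@enc_ord _) (data_init D) ++
  enc_rat (data_threshold D).

Lemma enc_rmabg_pinj : prefix_injective enc_rmabg.
Proof.
move=> [N m K r g p d i th] [N' m' K' r' g' p' d' i' th'] s t.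
rewrite /enc_rmabg /=.
move=> /(prefix_injective_cat enc_unary_pinj)[eN].
case: N' / eN r' g' p' i' => r' g' p' i'.
move=> /(prefix_injective_cat enc_unary_pinj)[em].
case: m' / em r' g' p' i' => r' g' p' i'.
move=> /(prefix_injective_cat enc_unary_pinj)[->].
have f3 := enc_ffun_pinj (enc_ffun_pinj (enc_ffun_pinj enc_rat_pinj)).
have f4 := enc_ffun_pinj
  (enc_ffun_pinj (enc_ffun_pinj (enc_ffun_pinj enc_rat_pinj))).
move=> /(prefix_injective_cat (f3 _ _ _))[->].
move=> /(prefix_injective_cat (enc_seq_pinj (@enc_weighted_gate_pinj _ _)))[->].
move=> /(prefix_injective_cat (f4 _ _ _ _))[->].
move=> /(prefix_injective_cat enc_rat_pinj)[->].
move=> /(prefix_injective_cat (enc_ffun_pinj (@enc_ord_pinj _)))[->].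
by move=> /enc_rat_pinj[-> ->].
Qed.

(* Threshold version of the maximization problem. *)

Definition RMAB_G (R : realType) : decision_problem :=
  @DecisionProblem rmabg_data enc_rmabg (prefix_injective_inj enc_rmabg_pinj)
    (fun D => well_formed (rmabg_of_data R D))
    (fun D => exists (pi : policy (data_arms D) 'I_(data_states D))
                     (v : \bar R),
       [/\ within_budget (rmabg_of_data R D) pi,
           has_value (rmabg_of_data R D) pi (data_init D) v &
           ((ratr (data_threshold D))%:E <= v)%E]).

(* Main.v *)
(* A machine deciding L in polynomial space rejects x exactly when its run
   reaches a rejecting state.  Hence x is in L if and only if a corridor of
   polynomial width, whose first row is the initial configuration, can be tiled
   forever by rows obeying 2 x 2 window rules that express a step of the machine
   and exclude rejecting states; no clock is needed.  Each bit of a row is an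
   arm, whose state consists of the current bit and the previous one; the action
   of an arm is its next bit.  So the arms are deterministic, a policy writes
   the rows one after the other, and a joint state shows two consecutive rows.
   The global reward is minus the number of violated windows: it ignores the
   actions, hence is monotone and submodular, and the value 0 is reached exactly
   when the rules are obeyed forever.  The code of this bandit consists of
   repetitive parts and of initial states that spell x; it is printed by nested
   loops over append-only tapes. *)

Require Import Defs.
From mathcomp Require Import all_boot all_order all_algebra.
From mathcomp Require Import all_classical all_reals all_analysis.
From mathcomp Require Import measurable_realfun.
From mathcomp Require Import zify.

Set Implicit Arguments.
Unset Strict Implicit.
Unset Printing Implicit Defensive.

Import Order.TTheory GRing.Theory Num.Theory.
Import numFieldNormedType.Exports.

Local Open Scope nat_scope.

(** * Pointwise updates of functions and polynomial bounds *)

Definition upd (A : Type) (f : nat -> A) (j : nat) (a : A) : nat -> A :=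
  fun i => if i == j then a else f i.

Lemma upd_eq (A : Type) (f : nat -> A) j a : upd f j a j = a.
Proof. by rewrite /upd eqxx. Qed.

Lemma upd_neq (A : Type) (f : nat -> A) j a i : i != j -> upd f j a i = f i.
Proof. by rewrite /upd => /negbTE ->. Qed.

Lemma upd_id (A : Type) (f : nat -> A) j : upd f j (f j) = f.
Proof. by apply: funext => i; rewrite /upd; case: eqP => [->|]. Qed.

Lemma upd_upd (A : Type) (f : nat -> A) j a b : upd (upd f j a) j b = upd f j b.
Proof. by apply: funext => i; rewrite /upd; case: eqP. Qed.

Lemma updC (A : Type) (f : nat -> A) i j a b : i != j ->
  upd (upd f i a) j b = upd (upd f j b) i a.
Proof.
move=> ij; apply: funext => l; rewrite /upd; case: (l =P j) => // ->.
by rewrite eq_sym (negbTE ij).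
Qed.

Lemma leq_expn2r m n k : m <= n -> m ^ k <= n ^ k.
Proof. by case: k => // k; rewrite leq_exp2r. Qed.

(** With a base of at least 2, constants, factors and sums are absorbed by the exponent; closure
    under sums and products then amounts to adding exponents. *)
Lemma poly_boundedP (f : nat -> nat) :
  poly_bounded f <-> exists k, forall n, f n <= n.+2 ^ k.
Proof.
split=> [[c [d H]]|[k H]].
  exists (c + d.+1) => n; apply: leq_trans (H n) _.
  have h1 : c <= n.+2 ^ c by apply/ltnW/ltn_expl.
  have h2 : n ^ d <= n.+2 ^ d by apply: leq_expn2r; lia.
  rewrite expnD expnS -mulnSr; apply: leq_mul => //.
  have : 0 < n.+2 ^ d by rewrite expn_gt0.
  move: h2; move: (n ^ d) (n.+2 ^ d) => u v; nia.
(* The factor comes from [n.+2 <= 3 * n] for positive [n]; the additive constant covers [n = 0]. *)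
exists (3 ^ k), k => n; apply: leq_trans (H n) _.
case: n => [|n]; first by apply: leq_trans (leq_addl _ _); exact: leq_expn2r.
by rewrite -expnMn; apply: leq_trans (leq_addr _ _); apply: leq_expn2r; lia.
Qed.

Lemma poly_bounded_cst c : poly_bounded (fun=> c).
Proof. by exists c, 0 => n; rewrite leq_addl. Qed.

Lemma poly_bounded_id : poly_bounded id.
Proof. by exists 1, 1 => n; rewrite mul1n expn1 leq_addr. Qed.

Lemma poly_boundedD f g : poly_bounded f -> poly_bounded g ->
  poly_bounded (fun n => f n + g n).
Proof.
move=> /poly_boundedP[k hf] /poly_boundedP[l hg]; apply/poly_boundedP.
exists (k + l).+1 => n; apply: leq_trans (leq_add (hf n) (hg n)) _.
rewrite expnS expnD.
have : 0 < n.+2 ^ k by rewrite expn_gt0.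
have : 0 < n.+2 ^ l by rewrite expn_gt0.
move: (n.+2 ^ k) (n.+2 ^ l) => u v; nia.
Qed.

Lemma poly_boundedM f g : poly_bounded f -> poly_bounded g ->
  poly_bounded (fun n => f n * g n).
Proof.
move=> /poly_boundedP[k hf] /poly_boundedP[l hg]; apply/poly_boundedP.
by exists (k + l) => n; rewrite expnD leq_mul.
Qed.

(** * Loop programs over append-only tapes *)

(** Bounded loops over words are the only control, so every program terminates. Nothing is erased,
    so the final contents of the tapes bound all intermediate ones. *)
Inductive prog :=
  | Skip
  | Put of nat & bool
  | Seq of prog & prog
  | For of nat & prog & prog.

Definition store := nat -> bitstring.

Fixpoint sem (p : prog) (s : store) : store :=
  match p with
  | Skip => s
  | Put j c => upd s j (rcons (s j) c)
  | Seq p1 p2 => sem p2 (sem p1 s)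
  | For j p0 p1 => foldl (fun s c => sem (if c then p1 else p0) s) s (s j)
  end.

(** The exact number of steps of the compiled program. In a loop, [(size (s j)).+2] steps rewind
    tape [j], each iteration adds one step to test the bit and one to advance, and a last step
    detects the end of the word. *)
Fixpoint cost (p : prog) (s : store) : nat :=
  match p with
  | Skip => 0
  | Put j c => 1
  | Seq p1 p2 => cost p1 s + cost p2 (sem p1 s)
  | For j p0 p1 => (size (s j)).+2 +
     (fix loop (w : bitstring) (s : store) : nat :=
       match w with
       | [::] => 1
       | c :: w' => cost (if c then p1 else p0) s + 2 +
                    loop w' (sem (if c then p1 else p0) s)
       end) (s j) s
  end.

(** A name for the anonymous recursion inside [cost], to allow inductions on the word read. *)
Definition loop_cost (p0 p1 : prog) :=
  fix loop (w : bitstring) (s : store) : nat :=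
    match w with
    | [::] => 1
    | c :: w' => cost (if c then p1 else p0) s + 2 +
                 loop w' (sem (if c then p1 else p0) s)
    end.

Lemma cost_For j p0 p1 s :
  cost (For j p0 p1) s = (size (s j)).+2 + loop_cost p0 p1 (s j) s.
Proof. by []. Qed.

(* Tape [0] is reserved to the input and tape [E] to the output: it is never
   read. *)
Fixpoint wfp (E : nat) (locked : seq nat) (p : prog) : bool :=
  match p with
  | Skip => true
  | Put j _ => [&& 0 < j, j <= E & j \notin locked]
  | Seq p1 p2 => wfp E locked p1 && wfp E locked p2
  | For j p0 p1 => [&& 0 < j, j < E, j \notin locked,
                     wfp E (j :: locked) p0 & wfp E (j :: locked) p1]
  end.

(** The word read by a loop is fixed by [sem] at the entry, whereas the machine reads it while the
    body runs; locking makes the two agree. *)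
Lemma sem_locked E locked p s j : wfp E locked p -> j \in locked ->
  sem p s j = s j.
Proof.
elim: p locked s => [|i c|p1 IH1 p2 IH2|i p0 IH0 p1 IH1] locked s //=.
- by case/and3P => _ _ hi hj; rewrite upd_neq//; apply: contraNneq hi => <-.
- by case/andP => h1 h2 hj; rewrite (IH2 locked)// (IH1 locked).
- case/and5P => _ _ _ h0 h1 hj.
  move: (s i) => w; elim: w s => //= c w IH s; rewrite IH.
  have hj' : j \in i :: locked by rewrite inE hj orbT.
  by case: c; [apply: (IH1 _ _ h1)|apply: (IH0 _ _ h0)].
Qed.

Lemma sem_size p s j : size (s j) <= size (sem p s j).
Proof.
elim: p s => [|i c|p1 IH1 p2 IH2|i p0 IH0 p1 IH1] s //=.
- by rewrite /upd; case: eqP => // ->; rewrite size_rcons.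
- exact: leq_trans (IH1 _) (IH2 _).
- move: (s i) => w; elim: w s => //= c w IH s; apply: leq_trans (IH _).
  by case: c.
Qed.

Fixpoint time_bound (p : prog) (B : nat) : nat :=
  match p with
  | Skip => 0
  | Put _ _ => 1
  | Seq p1 p2 => time_bound p1 B + time_bound p2 B
  | For _ p0 p1 => B.+3 + B * (time_bound p0 B + time_bound p1 B + 2)
  end.

(** Tapes only grow, so a bound on the final sizes holds at every loop entry. The output tape [E] is
    exempt because no loop reads it. *)
Lemma cost_le E locked p s B : wfp E locked p ->
  (forall j, 0 < j < E -> size (sem p s j) <= B) -> cost p s <= time_bound p B.
Proof.
elim: p locked s => [|i c|p1 IH1 p2 IH2|i p0 IH0 p1 IH1] locked s //.
- move=> /= /andP[h1 h2] hB; apply: leq_add.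
    apply: (IH1 _ _ h1) => j /hB; apply: leq_trans; exact: sem_size.
  exact: (IH2 _ _ h2).
- move=> wf; have [i0 iE _ h0 h1] := and5P wf; move=> hB; rewrite cost_For.
  have sB : size (s i) <= B.
    by apply: leq_trans (sem_size (For i p0 p1) s i) (hB _ _); rewrite i0 iE.
  set T := time_bound p0 B + time_bound p1 B + 2.
  suff : loop_cost p0 p1 (s i) s <= 1 + size (s i) * T.
    have := leq_mul sB (leqnn T).
    rewrite -/T /=; lia.
  move: hB => /=; move: (s i) sB => w _; elim: w s => [|c w IH] s hB //=.
  have hc : forall j, 0 < j < E -> size (sem (if c then p1 else p0) s j) <= B.
    move=> j /hB; apply: leq_trans => /=.
    move: (sem (if c then p1 else p0) s).
    elim: w {IH hB} => //= d w IH s'; apply: leq_trans (IH _).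
    exact: sem_size.
  have := IH _ hB.
  have : cost (if c then p1 else p0) s + 2 <= T.
    case: (c) hc => hc; rewrite /T.
      have := IH1 _ _ h1 hc; lia.
    have := IH0 _ _ h0 hc; lia.
  move: (loop_cost _ _ _ _) => L; lia.
Qed.

(** The program is fixed while the input varies: [time_bound p] is a polynomial whose degree depends
    on the nesting of loops only. *)
Lemma poly_bounded_time p B : poly_bounded B ->
  poly_bounded (fun n => time_bound p (B n)).
Proof.
move=> hB; elim: p => [|i c|p1 IH1 p2 IH2|i p0 IH0 p1 IH1] /=.
- exact: poly_bounded_cst.
- exact: poly_bounded_cst.
- exact: poly_boundedD.
- apply: poly_boundedD.
    have := poly_boundedD hB (poly_bounded_cst 3).
    by under eq_fun do rewrite addn3.
  apply: poly_boundedM => //; apply: poly_boundedD.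
    exact: poly_boundedD.
  exact: poly_bounded_cst.
Qed.

(** * Compilation to Turing machines *)

Section Compile.
Variable E : nat.

Let sym := option (bool + unit).

(* Fills cell [0] of the tapes read in loops, so that they can be rewound. *)
Definition marker : sym := Some (inr tt).

(* [iact] yields the next instruction, the symbol to write and the move. *)
Record instr := Instr { itape : nat; iact : sym -> nat * (sym * move) }.

(** [b] is the address of the first instruction. In a loop, [b] rewinds to the marker, [b.+1]
    branches on the scanned bit, and each body ends with a move to the right and a return to [b.+1];
    the exit is [b2.+1]. *)
Fixpoint compile (p : prog) (b : nat) : seq instr :=
  match p with
  | Skip => [::]
  | Put j c => [:: Instr j (fun=> (b.+1, (Some (inl c), MoveRight)))]
  | Seq p1 p2 => let c1 := compile p1 b in c1 ++ compile p2 (b + size c1)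
  | For j p0 p1 =>
    let c0 := compile p0 b.+2 in
    let b1 := b.+2 + size c0 in
    let c1 := compile p1 b1.+1 in
    let b2 := b1.+1 + size c1 in
    [:: Instr j (fun a => if a is Some (inr _) then (b.+1, (a, MoveRight))
                          else (b, (a, MoveLeft))),
        Instr j (fun a => match a with
                 | Some (inl true) => (b1.+1, (a, Stay))
                 | Some (inl false) => (b.+2, (a, Stay))
                 | _ => (b2.+1, (a, Stay))
                 end)
      & c0 ++ Instr j (fun a => (b.+1, (a, MoveRight))) ::
        c1 ++ [:: Instr j (fun a => (b.+1, (a, MoveRight)))]]
  end.

Definition machine_of (code : seq instr) : machine :=
  @Machine E 'I_(size code).+1 unit ord0
    (fun q => if q == size code :> nat then Some true else None)
    (fun q v =>
      let i := nth (Instr 0 (fun a => (0, (a, Stay)))) code q in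
      let r := iact i (v (inord (itape i))) in
      (inord r.1, fun j : 'I_E.+1 => if j == itape i :> nat then r.2 else (v j, Stay))).

Section Exec.
Variable code : seq instr.
Let M := machine_of code.

Definition conf (pc : nat) (h : nat -> nat) (t : nat -> seq sym) : config M :=
  @Config M (inord pc) h (fun j p => nth None (t j) p).

Definition code_at (b : nat) (c : seq instr) : Prop :=
  exists l r, code = l ++ c ++ r /\ b = size l.

Lemma code_at_cat b c1 c2 : code_at b (c1 ++ c2) ->
  code_at b c1 /\ code_at (b + size c1) c2.
Proof.
move=> [l [r [e ->]]]; split; first by exists l, (c2 ++ r); rewrite e -catA.
by exists (l ++ c1), r; rewrite e !catA size_cat.
Qed.

Lemma step_instr b i c h t : code_at b (i :: c) -> itape i <= E ->
  let a := nth None (t (itape i)) (h (itape i)) in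
  let r := iact i a in
  step (conf b h t) =
  conf r.1 (upd h (itape i) (move_head r.2.2 (h (itape i))))
     (upd t (itape i) (set_nth None (t (itape i)) (h (itape i)) r.2.1)).
Proof.
move=> [l [rr [e bl]]] iE a r; rewrite /step /= inordK; last first.
  rewrite e bl !size_cat /=; lia.
rewrite ltn_eqF; last by rewrite e bl !size_cat /=; lia.
have -> : nth (Instr 0 (fun a => (0, (a, Stay)))) code b = i.
  by rewrite e bl nth_cat ltnn subnn.
rewrite !ffunE /= inordK// -/a -/r; congr Config.
- apply: funext => j; rewrite /upd; case: eqP => [->|] //.
- apply: funext => j; apply: funext => p; rewrite /upd !ffunE.
  case: (_ =P itape i) => [->|_]; first by rewrite nth_set_nth.
  by case: eqP => //= ->.
Qed.

(** Writing back a symbol may lengthen the list that represents a tape, when a blank beyond its end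
    is read, but does not change the cells, which are all that [conf] retains. *)
Lemma step_read b i c h t m n : code_at b (i :: c) -> itape i <= E ->
  let a := nth None (t (itape i)) (h (itape i)) in
  iact i a = (n, (a, m)) ->
  step (conf b h t) = conf n (upd h (itape i) (move_head m (h (itape i)))) t.
Proof.
move=> hc iE a e; rewrite (step_instr _ _ hc iE) e /=; congr Config.
apply: funext => j; apply: funext => p; rewrite /upd; case: eqP => [->|_] //.
by rewrite nth_set_nth /=; case: eqP => // ->.
Qed.

Definition tape_of (s : store) (j : nat) : seq sym :=
  nseq (j != E) marker ++ [seq Some (inl b) | b <- s j].

(* A tape being read in a loop has its head on the current symbol, at position
   [i] of [l j = Some i]; the head of the other tapes is on the first blank. *)
Definition head_of (l : nat -> option nat) (s : store) (j : nat) : nat :=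
  (j != E) + if l j is Some i then i else size (s j).

Variables (h0 : nat) (t0 : seq sym).

(** Tape [0] is outside the store: it keeps the raw input [t0], and its head stays at [h0]. *)
Definition sconf (b : nat) (l : nat -> option nat) (s : store) :=
  conf b (upd (head_of l s) 0 h0) (upd (tape_of s) 0 t0).

Let correct (p : prog) := forall locked l b s, wfp E locked p ->
  (forall j, l j != None -> j \in locked) ->
  code_at b (compile p b) ->
  iter (cost p s) (@step M) (sconf b l s) =
  sconf (b + size (compile p b)) l (sem p s).

(** Induction on the program. Only locked tapes are in the middle of a reading, so a tape to which a
    body appends has its head at the end of its word. *)
Lemma compile_correct p : correct p.
Proof.
elim: p => [|j c|p1 IH1 p2 IH2|j p0 IH0 p1 IH1] locked l b s.
- by rewrite /= addn0.
- move=> /= /and3P[j0 jE jl] hl hc; rewrite addn1.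
  have lj : l j = None by apply/eqP; apply: contraNT jl; exact: hl.
  have j0' : j != 0 by rewrite -lt0n.
  rewrite /sconf (step_instr _ _ hc jE) /= !(updC _ _ _ (_ : 0 != j)) 1?eq_sym//.
  rewrite !upd_neq//.
  congr conf; congr upd; apply: funext => i; rewrite /upd.
    rewrite /head_of; case: (i =P j) => [->|ij].
      by rewrite lj ?eqxx ?size_rcons ?addnS.
    by case: (l i).
  rewrite /tape_of; case: (i =P j) => [->|//].
  rewrite map_rcons /head_of lj.
  set u := nseq _ _; set v := map _ _.
  have -> : (j != E) + size (s j) = size (u ++ v).
    by rewrite size_cat size_nseq size_map.
  rewrite -rcons_cat; elim: (u ++ v) => //= a w ->.
  by [].
- move=> /= /andP[w1 w2] hl /code_at_cat[hc1 hc2].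
  rewrite addnC iterD (IH1 locked)// (IH2 locked)//.
  by rewrite size_cat addnA.
- move=> wf hl; have [j0 jE jl w0 w1] := and5P wf.
  rewrite cost_For.
  set c0 := compile p0 b.+2; set b1 := b.+2 + size c0.
  set c1 := compile p1 b1.+1; set b2 := b1.+1 + size c1.
  move=> hc.
  have hR : code_at b (compile (For j p0 p1) b) by [].
  have [_ hS] := @code_at_cat b [:: _] _ hc.
  have [_ hc0'] := @code_at_cat _ [:: _] _ hS.
  rewrite /= !addn1 in hS hc0'.
  have [hc0 hM0'] := code_at_cat hc0'.
  have [hM0 hc1'] := @code_at_cat _ [:: _] _ hM0'.
  rewrite /= addn1 in hc1'.
  have [hc1 hM1] := code_at_cat hc1'.
  have lj : l j = None by apply/eqP; apply: contraNT jl; exact: hl.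
  have jE' : j <= E by exact: ltnW.
  have jnE : j != E by rewrite ltn_eqF.
  have j0' : j != 0 by rewrite -lt0n.
  have headl l' i s' : upd (head_of l' s') j i.+1 = head_of (upd l' j (Some i)) s'.
    apply: funext => r; rewrite /upd /head_of; case: (r =P j) => [->|//].
    by rewrite jnE.
  (* From position [n.+1] there are [n.+1] moves to the left, then one to the right off the marker
     in cell [0]. *)
  have rewind_left n : n <= size (s j) ->
    iter n.+2 (@step M) (conf b (upd (upd (head_of l s) 0 h0) j n.+1)
        (upd (tape_of s) 0 t0)) = sconf b.+1 (upd l j (Some 0)) s.
    elim: n => [|n IH] nw.
      rewrite iterSr (@step_read _ _ _ _ _ MoveLeft b hR) //=; last first.
        rewrite upd_eq upd_neq// /tape_of jnE /=.
        by case: (s j).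
      rewrite upd_upd upd_eq /=.
      rewrite (@step_read _ _ _ _ _ MoveRight b.+1 hR) //=; last first.
        by rewrite upd_eq upd_neq// /tape_of jnE /=.
      by rewrite upd_upd upd_eq /= updC 1?eq_sym// headl.
    rewrite iterSr (@step_read _ _ _ _ _ MoveLeft b hR) //=; last first.
      rewrite upd_eq upd_neq// /tape_of jnE /=.
      case: (ltnP n.+1 (size (s j))) => hn; first by rewrite (nth_map false).
      by rewrite nth_default// size_map.
    rewrite upd_upd upd_eq /=.
    exact: IH (ltnW nw).
  rewrite addnC iterD.
  have -> : sconf b l s = conf b (upd (upd (head_of l s) 0 h0) j (size (s j)).+1)
        (upd (tape_of s) 0 t0).
    rewrite /sconf; congr conf; rewrite updC 1?eq_sym//; congr upd.
    apply: funext => r; rewrite /upd /head_of; case: (r =P j) => [->|//].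
    by rewrite jnE lj.
  rewrite rewind_left//.
  have -> : size (compile (For j p0 p1) b) = (b2 - b).+1.
    by rewrite /= !size_cat /= size_cat /= /b2 /b1 -/c0 -/b1 -/c1; lia.
  have -> : b + (b2 - b).+1 = b2.+1.
    by rewrite /b2 /b1; move: (size c0) (size c1) => x y; lia.
  have IHp c : correct (if c then p1 else p0) by case: (c).
  have wlock : forall i r, upd l j (Some i) r != None -> r \in j :: locked.
    move=> i r; rewrite /upd inE; case: (r =P j) => //= _; exact: hl.
  (* Induction on the unread suffix [w], after [i] bits have been read; because of the marker, the
     head is at position [i.+1]. *)
  have scan w i s' : i + size w = size (s' j) -> drop i (s' j) = w ->
    iter (loop_cost p0 p1 w s') (@step M) (sconf b.+1 (upd l j (Some i)) s') =
    sconf b2.+1 l (foldl (fun s c => sem (if c then p1 else p0) s) s' w).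
    elim: w i s' => [|c w IH] i s' sw dw.
      (* At the end of the word the head is on the first blank, which is its place outside of loops,
         so [l] is restored. *)
      rewrite /= /sconf (@step_read _ _ _ _ _ Stay b2.+1 hS) //=; last first.
        rewrite !upd_neq//.
        suff -> : nth None (tape_of s' j) (head_of (upd l j (Some i)) s' j) = None by [].
        apply: nth_default; move: sw.
        by rewrite /tape_of /head_of upd_eq jnE /= size_map; lia.
      congr conf; rewrite upd_id; congr upd.
      apply: funext => r; rewrite /upd /head_of; case: (r =P j) => [->|//].
      by rewrite lj -sw addn0.
    have nthc : nth None (tape_of s' j) i.+1 = Some (inl c).
      rewrite /tape_of jnE /= (nth_map false); last by move: sw => /=; lia.
      by rewrite -[i]addn0 -nth_drop dw.
    have hj s2 : head_of (upd l j (Some i)) s2 j = i.+1.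
      by rewrite /head_of upd_eq jnE.
    pose bc := if c then b1.+1 else b.+2.
    pose p := if c then p1 else p0.
    have wp : wfp E (j :: locked) p by rewrite /p; case: (c).
    rewrite [loop_cost _ _ _ _]/= -/p.
    have -> : cost p s' + 2 + loop_cost p0 p1 w (sem p s') =
       loop_cost p0 p1 w (sem p s') + (1 + (cost p s' + 1)) by lia.
    rewrite iterD iterD iterD /=.
    rewrite [X in iter (cost p s') _ X](_ : _ = sconf bc (upd l j (Some i)) s'); last first.
      rewrite /sconf (@step_read _ _ _ _ _ Stay bc hS) //=.
        by rewrite upd_id.
      rewrite !upd_neq// hj nthc /bc.
      by case: (c).
    have hp : code_at bc (compile p bc) by rewrite /bc /p; case: (c).
    rewrite (IHp c (j :: locked))//; last exact: wlock.
    have [r hlast] : exists r, code_at (bc + size (compile p bc))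
        (Instr j (fun a => (b.+1, (a, MoveRight))) :: r).
      by rewrite /bc /p; case: (c); [exists [::]|eexists; exact: hM0].
    have sj : sem p s' j = s' j.
      by apply: (sem_locked _ wp); rewrite inE eqxx.
    rewrite {1}/sconf (@step_read _ _ _ _ _ MoveRight b.+1 hlast) //=.
    rewrite !upd_neq// hj updC 1?eq_sym//= headl upd_upd.
    rewrite -/(sconf _ _ _) (IH i.+1).
    + by [].
    + by rewrite sj -sw /= addSnnS.
    + by rewrite sj -add1n -drop_drop dw /= drop0.
  by rewrite scan// drop0.
Qed.

Lemma conf_ext b h h' t t' : (forall j, j <= E -> h j = h' j) ->
  (forall j, j <= E -> t j = t' j) -> conf b h t = conf b h' t'.
Proof.
move=> hh tt'; congr Config; apply: funext => j.
  by apply: hh; rewrite -ltnS.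
by apply: funext => p; rewrite /= tt' // -ltnS.
Qed.

End Exec.

(** * Initialization of the tapes and the complete machine *)

Definition mark_code : seq instr :=
  [seq Instr j.+1 (fun=> (j.+1, (marker, MoveRight))) | j <- iota 0 E.-1].

(** The input starts in cell [0] of its tape and leaves no room there for a marker; its copy on tape
    [1] can be rewound and read several times. *)
Definition copy_code (b : nat) : seq instr :=
  [:: Instr 0 (fun a => match a with
                | Some (inl true) => (b.+2, (a, Stay))
                | Some (inl false) => (b.+1, (a, Stay))
                | _ => (b.+4, (a, Stay))
                end);
      Instr 1 (fun=> (b.+3, (Some (inl false), MoveRight)));
      Instr 1 (fun=> (b.+3, (Some (inl true), MoveRight)));
      Instr 0 (fun a => (b, (a, MoveRight)))].

Definition code_of (p : prog) : seq instr :=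
  mark_code ++ copy_code E.-1 ++ compile p E.-1.+4.

Section Main.
Variables (p : prog) (x : bitstring).
Hypothesis E2 : 2 <= E.
Hypothesis wfpp : wfp E [::] p.
Let code := code_of p.
Let M := machine_of code.
Let tx : seq sym := [seq Some (inl b) | b <- x].

Lemma mark_ok : iter E.-1 (@step M) (initial_config M x) =
  sconf code 0 tx E.-1 (fun=> None) (fun=> [::]).
Proof.
suff H k : k <= E.-1 -> iter k (@step M) (initial_config M x) =
  conf code k (fun j => (0 < j <= k) : nat)
    (fun j => if j == 0 then tx else nseq (0 < j <= k) marker).
  rewrite H//; apply: conf_ext => j jE.
    rewrite /upd /head_of; case: (j =P 0) => [->//|j0] /=.
    by rewrite addn0; congr nat_of_bool; lia.
  rewrite /upd /tape_of; case: (j =P 0) => [//|j0] /=.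
  by rewrite cats0; congr nseq; congr nat_of_bool; lia.
elim: k => [|k IH] hk.
  rewrite /= /initial_config /conf; congr Config.
  - by apply: val_inj; rewrite /= inordK.
  - by apply: funext => j; case: (j : nat).
  - apply: funext => j; apply: funext => q; rewrite /= /written.
    rewrite (_ : (j == ord0) = (j == 0 :> nat))//; case: ifP => // j0.
    by case: (j : nat) => [|j'] /=; rewrite nth_nil.
rewrite iterS IH; last exact: ltnW.
have hc : code_at code k (Instr k.+1 (fun=> (k.+1, (marker, MoveRight))) ::
    drop k.+1 code).
  exists (take k code), [::]; rewrite cats0 size_take.
  have sk : size mark_code = E.-1 by rewrite size_map size_iota.
  have kc : k < size code by rewrite size_cat sk; lia.
  rewrite kc; split=> //; rewrite -[LHS](cat_take_drop k); congr cat.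
  rewrite (drop_nth (Instr 0 (fun a => (0, (a, Stay))))) //; congr cons.
  rewrite nth_cat sk hk (nth_map 0) ?size_iota// nth_iota//.
rewrite (step_instr _ _ hc) /=; last by lia.
apply: conf_ext => j jE; rewrite /upd; case: (j =P k.+1) => [->|/eqP jk].
- by rewrite /= ltnn ltnSn.
- by congr nat_of_bool; lia.
- by rewrite /= ltnn ltnSn.
- by case: (j == 0) => //; congr nseq; congr nat_of_bool; lia.
Qed.

(** Three steps per letter, to test, write and advance, and a last one that meets the blank. *)
Lemma copy_ok : iter ((size x * 3).+1) (@step M)
    (sconf code 0 tx E.-1 (fun=> None) (fun=> [::])) =
  sconf code (size x) tx E.-1.+4 (fun=> None) (upd (fun=> [::]) 1 x).
Proof.
have hc : code_at code E.-1 (copy_code E.-1).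
  exists mark_code, (compile p E.-1.+4); split=> //.
  by rewrite size_map size_iota.
have [_ h1] := @code_at_cat _ _ [:: _] _ hc.
have [_ h2] := @code_at_cat _ _ [:: _] _ h1.
have [_ h3] := @code_at_cat _ _ [:: _] _ h2.
rewrite /= !addn1 in h1 h2 h3.
have E1 : 1 != E by lia.
pose st i := sconf code i tx E.-1 (fun=> None) (upd (fun=> [::]) 1 (take i x)).
suff H i : i <= size x ->
    iter (i * 3) (@step M) (sconf code 0 tx E.-1 (fun=> None) (fun=> [::])) = st i.
  rewrite iterS H// /st /sconf take_size.
  rewrite (@step_read _ _ _ _ _ _ Stay E.-1.+4 hc) //=.
    by rewrite upd_id.
  by rewrite !upd_eq nth_default// size_map.
elim: i => [_|i IH hi].
  rewrite /= /st take0; congr sconf.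
  by apply: funext => j; rewrite /upd; case: eqP.
rewrite mulSnr addnC iterD IH; last exact: ltnW.
rewrite /st /sconf /=.
pose c := nth false x i.
have ti : nth None tx i = Some (inl c) by rewrite /tx (nth_map false).
rewrite (@step_read _ _ _ _ _ _ Stay (if c then E.-1.+2 else E.-1.+1) hc) //=; last first.
  by rewrite !upd_eq ti; case: (c).
rewrite upd_id.
have [i' [hi' i1 ic]] : exists i', [/\ code_at code (if c then E.-1.+2 else E.-1.+1) [:: i'] ,
    itape i' = 1 & iact i' = (fun=> (E.-1.+3, (Some (inl c), MoveRight)))].
  case: (c).
    by eexists; split; first exact: (code_at_cat (c1 := [:: _]) h2).1.
  by eexists; split; first exact: (code_at_cat (c1 := [:: _]) h1).1.
rewrite (step_instr _ _ hi'); last by rewrite i1; lia.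
rewrite i1 ic /= !(upd_neq _ _ (isT : 1 != 0)).
rewrite (@step_read _ _ _ _ _ _ MoveRight E.-1 h3) //=.
apply: conf_ext => j jE.
  rewrite /upd /head_of; case: (j =P 0) => [//|j0].
  case: (j =P 1) => [->|//]; rewrite eqxx E1 !size_take hi.
  by case: ltnP; lia.
rewrite /upd /tape_of /head_of; case: (j =P 0) => [->//|j0].
case: (j =P 1) => [->|//]; rewrite /= E1 (take_nth false) // map_rcons -/c.
set v := map _ _; have -> : size (take i x) = size v by rewrite size_map.
by rewrite /=; congr cons; elim: v => //= a v ->.
Qed.

Lemma prog_run : let s := sem p (upd (fun=> [::]) 1 x) in
  exists n h, n <= E + (size x * 3).+1 + cost p (upd (fun=> [::]) 1 x) /\
  run M x n = conf code (size code) h (upd (tape_of s) 0 tx).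
Proof.
move=> s.
have hc : code_at code E.-1.+4 (compile p E.-1.+4).
  exists (mark_code ++ copy_code E.-1), [::]; rewrite cats0 -catA; split=> //.
  by rewrite size_cat size_map size_iota /=; lia.
have H := compile_correct (size x) tx (upd (fun=> [::]) 1 x) (l := fun=> None)
  wfpp _ hc.
exists (cost p (upd (fun=> [::]) 1 x) + ((size x * 3).+1 + E.-1)).
eexists; split; first by lia.
rewrite /run iterD iterD mark_ok copy_ok H// /sconf.
rewrite (_ : E.-1.+4 + _ = size code) //.
by rewrite !size_cat size_map size_iota /=; lia.
Qed.

End Main.

(** Polynomial time is reduced to polynomial size of the auxiliary tapes. Tape [E] carries no
    marker, so the result starts in its leftmost cell, as [computes_in_time] requires. *)
Lemma prog_polytime (p : prog) (f : bitstring -> bitstring) (B : nat -> nat) :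
  2 <= E -> wfp E [::] p -> poly_bounded B ->
  (forall x, let s := sem p (upd (fun=> [::]) 1 x) in
     s E = f x /\ forall j, 0 < j < E -> size (s j) <= B (size x)) ->
  polytime f.
Proof.
move=> E2 wfpp hB H.
exists (machine_of (code_of p)).
exists (fun n => E + (n * 3 + 1) + time_bound p (B n)); split.
  apply: poly_boundedD; last exact: poly_bounded_time.
  apply: poly_boundedD; first exact: poly_bounded_cst.
  apply: poly_boundedD; last exact: poly_bounded_cst.
  by apply: poly_boundedM; [exact: poly_bounded_id|exact: poly_bounded_cst].
move=> x; have [/= Hf hs] := H x.
have [n [h [hn e]]] := prog_run x E2 wfpp.
have hc := cost_le wfpp hs.
set t := (t in run _ _ t).
have nt : n <= t by rewrite /t; lia.
(* The halting configuration is a fixed point, so the run can be prolonged to a time that depends on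
   the size of the input only. *)
have -> : run (machine_of (code_of p)) x t =
    run (machine_of (code_of p)) x n.
  rewrite -(subnK nt) /run iterD -/(run _ x n); elim: (t - n) => //= k ->.
  by rewrite e /step /= inordK// eqxx.
rewrite e; split; first by rewrite /= inordK// eqxx.
move=> q; rewrite /= upd_neq; last by rewrite -lt0n; lia.
by rewrite /tape_of eqxx Hf.
Qed.

End Compile.

(** * Space-bounded computations as tilings of a corridor *)

(** One first tile, [n] letters and [n.+2 ^ D] blanks: a sum that loops over the input and over a
    unary power can follow. *)
Definition width (D n : nat) : nat := (n + n.+2 ^ D).+1.

Definition tiling (G : Type) (ok : G -> G -> G -> G -> bool) (W : nat)
    (r : nat -> nat -> G) : Prop :=
  forall t p, p.+1 < W -> ok (r t p) (r t p.+1) (r t.+1 p) (r t.+1 p.+1).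

Definition tileable (G : Type) (ok : G -> G -> G -> G -> bool) (W : nat)
    (r0 : nat -> G) : Prop :=
  exists r, (forall p, p < W -> r 0 p = r0 p) /\ tiling ok W r.

Section Tiles.
Variable M : machine.

Let tape := tape_index M.
Let sym := symbol M.

(* Row [t] has one tile for each position [p.+1] of the tapes of the
   configuration at time [t], after a first marked tile.  Every tile of the row
   holds the control state and the symbols scanned at time [t.-1]; the Boolean
   of tape [j] tells whether [p.+1 <= head j], so that the head is where this
   Boolean drops from true to false. *)
Definition tile : finType :=
  (bool * (control M * {ffun tape -> sym}) *
   ({ffun tape -> sym} * {ffun tape -> bool}))%type.

Definition mark (a : tile) : bool := a.1.1.
Definition ctl (a : tile) : control M := a.1.2.1.
Definition scanned (a : tile) : {ffun tape -> sym} := a.1.2.2.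
Definition cells (a : tile) : {ffun tape -> sym} := a.2.1.
Definition upto (a : tile) : {ffun tape -> bool} := a.2.2.

(** Halting states are frozen as in [step], so an accepting run still yields infinitely many
    rows. *)
Definition update (q : control M) (v : {ffun tape -> sym}) :
    control M * (tape -> sym * move) :=
  if verdict q is Some _ then (q, fun j => (v j, Stay)) else transition q v.

(** If [a] is at position [p], then [here] places the head on cell [p], which is held by [b]. A move
    shifts the Booleans by one tile. For a move to the left, the first tile is governed by
    [ok_tiles], and [upto b' ==> upto b] governs the last one, which has no right neighbour. *)
Definition tape_ok (a b a' b' : tile) (act : tape -> sym * move) (j : tape) :
    bool :=
  let here := upto a j && ~~ upto b j in
  [&& here ==> (scanned b' j == cells b j),
      cells b' j == (if here then (act j).1 else cells b j) &
      match (act j).2 with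
      | Stay => upto b' j == upto b j
      | MoveRight => upto b' j == upto a j
      | MoveLeft => (mark a || (upto a' j == upto b j)) &&
                    (upto b' j ==> upto b j)
      end].

(** The scanned symbols are a guess of the new row: it is kept constant along the row and verified,
    tape by tape, at the window that contains the head. *)
Definition ok_tiles (a b a' b' : tile) : bool :=
  let u := update (ctl b) (scanned b') in
  [&& scanned a' == scanned b',
      mark a' == mark a, mark b' == mark b,
      mark a ==> [forall j, upto a' j],
      verdict (ctl b) != Some false,
      ctl a' == u.1, ctl b' == u.1 &
      [forall j, tape_ok a b a' b' u.2 j]].

Definition first_tile : tile :=
  (true, (start M, [ffun=> None]), ([ffun=> None], [ffun=> true])).
Definition letter_tile (b : bool) : tile :=
  (false, (start M, [ffun=> None]),
   ([ffun j => if j == ord0 then Some (inl b) else None], [ffun=> false])).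
Definition blank_tile : tile :=
  (false, (start M, [ffun=> None]), ([ffun=> None], [ffun=> false])).

Lemma step_update (c : config M) :
  let v := [ffun j => cell c j (Defs.head c j)] in
  let u := update (state c) v in
  [/\ state (step c) = u.1,
      forall j, Defs.head (step c) j = move_head (u.2 j).2 (Defs.head c j) &
      forall j p, cell (step c) j p =
        if p == Defs.head c j then (u.2 j).1 else cell c j p].
Proof.
rewrite /step /update; case: (verdict _) => [b|]; split=> //= j p.
by rewrite ffunE; case: eqP => // ->.
Qed.

Variables (W : nat) (x : bitstring).
Hypothesis headW : forall t j, (Defs.head (run M x t) j).+1 < W.

Let r0 := nth blank_tile (first_tile :: map letter_tile x).

Definition describes (c : config M) (r : nat -> tile) : Prop :=
  forall p, p < W ->
  [/\ mark (r p) = (p == 0), ctl (r p) = state c,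
      forall j, upto (r p) j = (p <= Defs.head c j) &
      forall j q, p = q.+1 -> cells (r p) j = cell c j q].

Lemma initial_tile p : r0 p.+1 = (false, (start M, [ffun=> None]),
  ([ffun j => if j == ord0 then written M x p else None], [ffun=> false])).
Proof.
have E w q : nth None [seq Some (inl b) | b <- w] q =
    if q < size w then Some (inl (nth false w q)) else None :> sym.
  by case: ltnP => qw; [rewrite (nth_map false)|rewrite nth_default ?size_map].
rewrite /r0 /= /written E; case: ltnP => px.
  by rewrite (nth_map false).
rewrite nth_default ?size_map// /blank_tile; do 2 congr pair.
by apply/ffunP => j; rewrite !ffunE if_same.
Qed.

Lemma describes0 : describes (run M x 0) r0.
Proof.
move=> [|p] pW; first by split=> // j; rewrite ffunE.
rewrite initial_tile; split=> // j; first by rewrite /upto /= ffunE.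
by move=> q [<-]; rewrite /cells /= ffunE.
Qed.

(** The rules leave no choice: by induction on time, each row determines the control state, heads
    and cells shown by the next. *)
Lemma tiling_run r : (forall p, p < W -> r 0 p = r0 p) ->
  tiling ok_tiles W r -> forall t, describes (run M x t) (r t).
Proof.
move=> h0 hr; elim=> [|t IH].
  by move=> p pW; rewrite h0//; exact: describes0.
set c := run M x t in IH *.
have -> : run M x t.+1 = step c by [].
have [e1 e2 e3] := step_update c.
move: e1 e2 e3; set v := finfun _; set u := update _ _ => e1 e2 e3.
have W1 : 1 < W by apply: leq_ltn_trans (headW 0 ord0).
(* The whole row shares one guess, and the window at the head of tape [j], which lies in the
   corridor by [headW], forces its value at [j]. *)
have scE p : p < W -> scanned (r t.+1 p) = v.
  have sc0 q : q < W -> scanned (r t.+1 q) = scanned (r t.+1 0).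
    elim: q => // q IHq qW; rewrite -IHq 1?ltnW//.
    by have /and5P[/eqP-> _ _ _ _] := hr t q qW.
  move=> pW; rewrite sc0//; apply/ffunP => j.
  have hW := headW t j; have [_ _ u1 _] := IH _ (ltnW hW).
  have [_ _ u2 c2] := IH _ hW.
  have /and5P[_ _ _ _ /and4P[_ _ _ /forallP/(_ j)]] := hr t _ hW.
  move=> /and3P[+ _ _]; rewrite u1 u2 leqnn ltnn /= sc0// => /eqP ->.
  by rewrite (c2 _ _ erefl) ffunE.
have key p : p.+1 < W ->
  [/\ mark (r t.+1 p) = (p == 0), mark (r t.+1 p.+1) = false,
      ctl (r t.+1 p) = u.1, ctl (r t.+1 p.+1) = u.1 &
     (p = 0 -> forall j, upto (r t.+1 p) j) /\
     forall j, tape_ok (r t p) (r t p.+1) (r t.+1 p) (r t.+1 p.+1) u.2 j].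
  move=> pW; have [m1 _ _ _] := IH _ (ltnW pW); have [m2 c2 _ _] := IH _ pW.
  have := hr t p pW; rewrite /ok_tiles m1 m2 c2 (scE p.+1)// -/u.
  move=> /and5P[_ /eqP -> /eqP -> h /and4P[_ /eqP-> /eqP-> /forallP h']].
  split=> //; split=> // p0; move: h; rewrite p0 => /forallP; exact.
have ctlE p : p < W -> ctl (r t.+1 p) = u.1 /\ mark (r t.+1 p) = (p == 0).
  by case: p => [|p] pW; [have [-> _ -> _ _] := key 0 W1|
     have [_ -> _ -> _] := key p pW].
move=> p pW; have [cE mE] := ctlE p pW; split=> //; first by rewrite cE e1.
- move=> j; rewrite e2; case: p pW {cE mE} => [|p] pW.
    by have [_ _ _ _ [h _]] := key 0 W1; rewrite h.
  have [_ _ _ _ [_ /(_ j)/and3P[_ _]]] := key p pW.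
  have [_ _ u1 _] := IH _ (ltnW pW); have [_ _ u2 _] := IH _ pW.
  rewrite u1 u2; case E: (u.2 j).2 => /=.
  (* For a move to the left, the new Boolean is given by the window on the right of the tile. The
     last tile has no such window, but [headW] makes its Boolean false. *)
  + case: (ltnP p.+2 W) => p2W.
      have [_ _ _ _ [_ /(_ j)/and3P[_ _]]] := key p.+1 p2W.
      have [m1 _ _ _] := IH _ pW; have [_ _ u3 _] := IH _ p2W.
      rewrite E m1 u3 /= => /andP[/eqP -> _] _; lia.
    have := headW t j; rewrite -/c => hW /andP[_].
    have -> : (p < Defs.head c j) = false by lia.
    rewrite implybF => /negbTE ->; lia.
  + by move=> /eqP ->.
  + by move=> /eqP ->.
- move=> j q pq; rewrite {}pq in pW *; rewrite e3.
  have [_ _ _ _ [_ /(_ j)/and3P[_ /eqP -> _]]] := key q pW.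
  have [_ _ u1 _] := IH _ (ltnW pW); have [_ _ u2 c2] := IH _ pW.
  rewrite u1 u2 (c2 _ _ erefl) -leqNgt.
  by rewrite (_ : (q <= Defs.head c j <= q) = (q == Defs.head c j))// eqn_leq.
Qed.

Lemma run_tiling : (forall t, verdict (state (run M x t)) <> Some false) ->
  tileable ok_tiles W r0.
Proof.
move=> noF.
(* Row [0] has no predecessor; its default agrees with the tiles of [r0]. *)
pose sc t : {ffun tape -> sym} := if t is t'.+1 then
  [ffun j => cell (run M x t') j (Defs.head (run M x t') j)] else [ffun=> None].
pose r t p : tile := (p == 0, (state (run M x t), sc t),
  ([ffun j => if p is q.+1 then cell (run M x t) j q else None],
   [ffun j => p <= Defs.head (run M x t) j])).
exists r; split.
  move=> [|p] pW; rewrite /r /=.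
    by congr (_, (_, _), (_, _)); apply/ffunP => j; rewrite !ffunE.
  rewrite -/(r0 p.+1) initial_tile.
  by congr (_, (_, _), (_, _)); apply/ffunP => j; rewrite !ffunE.
move=> t p pW; set c := run M x t.
have [e1 e2 e3] := step_update c.
move: e1 e2 e3; rewrite -/(sc t.+1); set u := update _ _ => e1 e2 e3.
rewrite /ok_tiles; apply/and5P; split=> //.
  by apply/implyP => /eqP p0; apply/forallP => j; rewrite ffunE p0.
apply/and4P; split.
- by apply/eqP; exact: noF.
- by rewrite /ctl /= e1.
- by rewrite /ctl /= e1.
apply/forallP => j; rewrite /tape_ok /upto /cells /scanned /mark /=.
rewrite !ffunE -/c -leqNgt -eqn_leq -/u.
have -> : u.2 = (update (state c) (sc t.+1)).2 by [].
rewrite -/u; apply/and3P; split.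
- by apply/implyP => /eqP ->.
- by rewrite e3.
- rewrite e2; case: (u.2 j).2 => //=.
  apply/andP; split; last by lia.
  by case: p {pW} => [//|p] /=; apply/eqP; lia.
Qed.

End Tiles.

Lemma run_halted (M : machine) x t t' b : verdict (state (run M x t)) = Some b ->
  t <= t' -> run M x t' = run M x t.
Proof.
move=> h /subnK <-; rewrite /run iterD -/(run M x t).
by elim: (t' - t) => //= k ->; rewrite /step h.
Qed.

(** Since every run halts, acceptance means that no rejecting state ever occurs: a safety property,
    which an infinite tiling can express. *)
Lemma PSPACE_tileable (L : language) : PSPACE L ->
  exists (G : finType) (ok : G -> G -> G -> G -> bool) (first blank : G)
         (letter : bool -> G) (D : nat),
  forall x, L x <->
    tileable ok (width D (size x)) (nth blank (first :: map letter x)).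
Proof.
move=> [M [sp [/poly_boundedP[D hsp] hM dM]]].
exists (tile M), (@ok_tiles M), (first_tile M), (blank_tile M).
exists (@letter_tile M), D => x.
have hW t j : (Defs.head (run M x t) j).+1 < width D (size x).
  have := hM x t j; have := hsp (size x); rewrite /width; lia.
split=> [Lx|[r [h0 hr]]].
  apply: run_tiling => // t vF.
  have [t' [b [vb hb]]] := dM x.
  (* At a common later time the rejecting and the accepting configuration would coincide. *)
  have := run_halted vF (leq_maxl t t'); rewrite (run_halted vb (leq_maxr t t')).
  by move/(congr1 (fun c => verdict (state c))); rewrite vF vb hb.2.
have [t [b [vb hb]]] := dM x.
apply/hb; case: b vb {hb} => // vF.
have D0 := tiling_run hW h0 hr.
have hW0 : 1 < width D (size x) := leq_ltn_trans (ltn0Sn _) (hW 0 ord0).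
have /and5P[_ _ _ _ /and4P[+ _ _ _]] := hr t 0 hW0.
have [_ -> _ _] := D0 t 1 hW0.
by rewrite vF eqxx.
Qed.

(** * Deterministic bandits *)

Section Deterministic.
Local Open Scope classical_set_scope.
Local Open Scope ring_scope.
Variables (R : realType) (N : nat) (S : finType) (B : rmabg R N S).
Variable next : S -> bool -> S.
Hypothesis transitionE : forall i s a s',
  arm_transition B i s a s' = (s' == next s a)%:R.
Hypothesis discount01 : 0 < discount B < 1.

Definition joint_next (pi : policy N S) (s : joint_state N S) :
  joint_state N S := [ffun i => next (s i) (pi s i)].

Definition trajectory (pi : policy N S) (s0 : joint_state N S) (t : nat) :
  joint_state N S := iter t (joint_next pi) s0.

Lemma joint_transition_next pi s s' :
  joint_transition B s (pi s) s' = (s' == joint_next pi s)%:R.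
Proof.
rewrite /joint_transition; case: eqP => [->|ne].
  by rewrite big1// => i _; rewrite transitionE ffunE eqxx.
have [i ine] : exists i, s' i != joint_next pi s i.
  apply/existsP; rewrite -negb_forall; apply: contra_notN ne => /forallP h.
  by apply/ffunP => i; apply/eqP.
rewrite (bigD1 i)//= transitionE; move: ine; rewrite ffunE => /negbTE ->.
by rewrite mul0r.
Qed.

(** The law of a deterministic chain is the Dirac mass at its trajectory. *)
Lemma path_probability pi s0 t (h : nat -> joint_state N S) :
  (h 0%N == s0)%:R *
    \prod_(k < t) joint_transition B (h k) (pi (h k)) (h k.+1) =
  [forall k : 'I_t.+1, h k == trajectory pi s0 k]%:R :> R.
Proof.
elim: t => [|t IH].
  rewrite big_ord0 mulr1; congr (_%:R); congr nat_of_bool.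
  by apply/idP/forallP => [/eqP h0 k|/(_ ord0)//]; rewrite ord1 h0.
rewrite big_ord_recr mulrA IH /= joint_transition_next -natrM mulnb.
congr (_%:R); congr nat_of_bool; apply/andP/forallP => [[/forallP h1 /eqP h2] k|h1].
  case: (ltnP k t.+1) => kt; first by have := h1 (Ordinal kt).
  have -> : k = t.+1 :> nat by apply/eqP; rewrite eqn_leq kt -ltnS ltn_ord.
  by rewrite h2 /trajectory iterS (eqP (h1 ord_max)).
split; first by apply/forallP => k; have := h1 (widen_ord (leqnSn _) k).
have := h1 ord_max => /= /eqP ->.
have := h1 (widen_ord (leqnSn _) ord_max) => /= /eqP ->.
exact: eqxx.
Qed.

Lemma reward_bounded : exists C, forall s a, `|reward B s a| <= C.
Proof.
exists (\sum_(s : joint_state N S) \sum_(a : joint_action N) `|reward B s a|).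
move=> s a; rewrite (bigD1 s)//= (bigD1 a)//= -addrA lerDl.
by apply: addr_ge0; repeat (apply: sumr_ge0 => ? _).
Qed.

Lemma cvg_discounted pi (h : nat -> joint_state N S) :
  cvgn (series (fun t => discount B ^+ t * reward B (h t) (pi (h t)))).
Proof.
have /andP[d0 d1] := discount01; have [C hC] := reward_bounded.
apply: normed_cvg.
apply: (@series_le_cvg _ _ (geometric C (discount B))).
- by move=> n; exact: normr_ge0.
- move=> n; apply: mulr_ge0; last by rewrite exprn_ge0// ltW.
  by apply: le_trans (hC (h 0%N) (pi (h 0%N))); exact: normr_ge0.
- move=> n /=; rewrite normrM ger0_norm ?exprn_ge0 ?(ltW d0)// mulrC.
  by apply: ler_wpM2r; rewrite ?exprn_ge0 ?(ltW d0).
- by apply: is_cvg_geometric_series; rewrite ger0_norm ?(ltW d0).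
Qed.

(** The return is a pointwise limit of finite sums, whose terms are measurable because the state
    takes finitely many values on measurable fibres. *)
Lemma measurable_discounted pi d (Omega : measurableType d)
    (X : nat -> Omega -> joint_state N S) :
  (forall t s, measurable [set w | X t w = s]) ->
  measurable_fun setT (fun w => discounted_return B pi (fun t => X t w)).
Proof.
move=> mX.
have mg t (g : joint_state N S -> R) : measurable_fun setT (fun w => g (X t w)).
  move=> _ Y mY; rewrite setTI.
  have -> : (fun w => g (X t w)) @^-1` Y =
      \bigcup_(s in [set s | Y (g s)]) [set w | X t w = s].
    by apply/seteqP; split=> [w /= Yw|w [s /= Ys Xs]]; [exists (X t w)|rewrite Xs].
  by apply: fin_bigcup_measurable => //; exact: finite_finset.
apply: (@measurable_fun_cvg _ _ _ _ (fun n w => series (fun t =>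
    discount B ^+ t * reward B (X t w) (pi (X t w))) n)).
  move=> n; rewrite /series /=; apply: measurable_sum => t.
  exact: (mg t (fun s => discount B ^+ t * reward B s (pi s))).
by move=> w _; exact: (@cvg_discounted pi (fun t => X t w)).
Qed.

(** A one-point space carries a controlled process; conversely, any controlled process almost surely
    follows the trajectory, so its expected return is the integral of a constant. *)
Lemma has_value_trajectory pi s0 v : has_value B pi s0 v <->
  v = (discounted_return B pi (trajectory pi s0))%:E.
Proof.
split=> [[d [T [Pr [X [[mX lX] ->]]]]]|->]; last first.
  have PE A : (\d_tt : probability unit R) A = (tt \in A)%:R%:E by exact: diracE.
  exists _, unit, (\d_tt : probability unit R), (fun t _ => trajectory pi s0 t).
  split; last by rewrite expectation_cst.
  split=> // t h; rewrite path_probability PE.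
  congr (_%:R%:E); congr nat_of_bool; apply/idP/forallP => [|H].
    by rewrite inE /= => H k; rewrite H// -ltnS.
  by rewrite inE /= => k kt; apply/esym/eqP; have := H (Ordinal (kt : (k < t.+1)%N)).
rewrite unlock /= -[RHS]mule1 -(probability_setT Pr) -integral_cst//.
apply: ae_eq_integral => //.
  by apply/measurable_EFinP; exact: measurable_discounted.
(* A countable intersection of events of probability one, one for each finite horizon. *)
have : \forall w \ae Pr, forall t, forall k, (k <= t)%N -> X k w = trajectory pi s0 k.
  apply/ae_foralln => t.
  have mA : measurable [set w | forall k, (k <= t)%N -> X k w = trajectory pi s0 k].
    rewrite (_ : mkset _ = \bigcap_(k in [set k | (k <= t)%N])
       [set w | X k w = trajectory pi s0 k]); first exact: bigcap_measurableType.
    by apply/seteqP; split.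
  set A := mkset _ in mA.
  have PA : Pr (~` A) = 0%E.
    rewrite probability_setC// lX path_probability.
    by rewrite (_ : [forall _, _] = true) ?subee//; apply/forallP => k.
  by exists (~` A); split=> //; exact: measurableC.
apply: filterS => w H _ /=; congr (discounted_return _ _ _)%:E.
by apply: funext => t; exact: H.
Qed.

(** A sum of nonpositive terms reaches [0] only if all of them vanish; positivity of the discount
    then gives zero rewards. *)
Lemma discounted_return_ge0 pi (h : nat -> joint_state N S) :
  (forall s a, reward B s a <= 0) ->
  0 <= discounted_return B pi h <-> forall t, reward B (h t) (pi (h t)) = 0.
Proof.
move=> r0; have /andP[d0 d1] := discount01.
have cv := @cvg_discounted pi h; split=> [H t|H]; last first.
  rewrite /discounted_return (_ : (fun _ => _) = fun=> 0).
    by rewrite /series /=; under eq_fun do rewrite big1//; rewrite lim_cst.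
  by apply: funext => t; rewrite H mulr0.
apply/eqP; rewrite eq_le r0 /= leNgt; apply/negP => rt.
move: H; apply/negP; rewrite -ltNge.
(* From rank [t.+1] on, every partial sum is at most its term of index [t], which is negative. *)
apply: (@le_lt_trans _ _ (discount B ^+ t * reward B (h t) (pi (h t)))); last first.
  by rewrite pmulr_rlt0// exprn_gt0.
apply: limr_le => //; exists t.+1 => // n /= tn.
rewrite /series /= (big_cat_nat (n := t.+1))//= big_nat_recr//= addrAC gerDr.
by rewrite -oppr_ge0 opprD -!sumrN addr_ge0// sumr_ge0// => k _;
  rewrite oppr_ge0 pmulr_rle0 ?exprn_gt0.
Qed.

End Deterministic.

(** * Circuits for Boolean functions of a window of arms *)

Inductive bexpr :=
  | BIn of nat & 'I_4
  | BCst of bool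
  | BNeg of bexpr
  | BAnd of bexpr & bexpr.

Fixpoint beval (u : nat -> 'I_4) (e : bexpr) : bool :=
  match e with
  | BIn l v => u l == v
  | BCst b => b
  | BNeg e => ~~ beval u e
  | BAnd e1 e2 => beval u e1 && beval u e2
  end.

Fixpoint inputs_below (n : nat) (e : bexpr) : bool :=
  match e with
  | BIn l _ => l < n
  | BCst _ => true
  | BNeg e => inputs_below n e
  | BAnd e1 e2 => inputs_below n e1 && inputs_below n e2
  end.

Lemma inputs_belowW m n e : m <= n -> inputs_below m e -> inputs_below n e.
Proof.
move=> mn; elim: e => //= [l _|e1 IH1 e2 IH2].
  by move=> /leq_trans; exact.
by case/andP => /IH1 -> /IH2 ->.
Qed.

(** Shannon expansion on the last input. The size is exponential in [n], which is harmless: the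
    windows to be tested depend on the machine and not on its input. *)
Lemma bexpr_complete n (V : (nat -> 'I_4) -> bool) :
  (forall u u', (forall l, l < n -> u l = u' l) -> V u = V u') ->
  exists e, inputs_below n e /\ forall u, beval u e = V u.
Proof.
elim: n V => [|n IH] V hV.
  by exists (BCst (V (fun=> ord0))); split=> // u; exact: hV.
pose V' (v : 'I_4) u := V (fun l => if l == n then v else u l).
have hV' v : {e | inputs_below n e /\ forall u, beval u e = V' v u}.
  apply/cid/IH => u u' uu'; apply: hV => l ln; case: eqP => // /eqP ne.
  by apply: uu'; rewrite ltn_neqAle ne -ltnS.
pose ev v := sval (hV' v).
(* The conjunction over [v] of the implications from [u n == v] to [V' v u], written with negations
   and conjunctions. *)
pose e := foldr (fun v e => BAnd (BNeg (BAnd (BIn n v) (BNeg (ev v)))) e)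
  (BCst true) (enum 'I_4).
exists e; split.
  rewrite /e; elim: (enum 'I_4) => //= v vs ->; rewrite ltnSn /= andbT.
  exact: (inputs_belowW (leqnSn n) (svalP (hV' v)).1).
move=> u; have -> : V u = V' (u n) u.
  by apply: hV => l _; case: eqP => // ->.
have -> : beval u e = all (fun v => (u n == v) ==> V' v u) (enum 'I_4).
  rewrite /e; elim: (enum 'I_4) => //= v vs ->.
  by rewrite (svalP (hV' v)).2 negb_and negbK implybE.
apply/allP/idP => [/(_ (u n))|h v _]; first by rewrite mem_enum eqxx; exact.
by apply/implyP => /eqP <-.
Qed.

(* A gate of the circuit of a window; the inputs are relative to the first arm
   of the window. *)
Inductive tgate :=
  | TIn of nat & 'I_4
  | TCst of bool
  | TNot of nat
  | TAnd of nat & nat.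

(** Only the last gate, which computes [e], carries the weight [w]. Seen from a conjunction, the
    last gate of [e2] is just before and that of [e1] is [size c2] places further back. Relative
    references let circuits be concatenated. *)
Fixpoint circuit_of (e : bexpr) (w : rat) : seq (tgate * rat) :=
  match e with
  | BIn l v => [:: (TIn l v, w)]
  | BCst b => [:: (TCst b, w)]
  | BNeg e => circuit_of e 0%R ++ [:: (TNot 0, w)]
  | BAnd e1 e2 =>
    let c2 := circuit_of e2 0%R in
    circuit_of e1 0%R ++ c2 ++ [:: (TAnd 0 (size c2), w)]
  end.

Section Place.
Variables (N : nat) (N0 : 0 < N).

(* Junk value [i %% N] out of range. *)
Definition arm (i : nat) : 'I_N := Ordinal (ltn_pmod i N0).

Definition place (o : nat) (g : tgate * rat) : gate N 4 * rat :=
  (match g.1 with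
   | TIn l v => StateInput (arm (o + l)) v
   | TCst b => Const _ _ b
   | TNot k => Not _ _ k
   | TAnd k l => And _ _ k l
   end, g.2).

Definition window (s : joint_state N 'I_4) (o : nat) : nat -> 'I_4 :=
  fun l => s (arm (o + l)).

(** [vs'] holds the values of the inner gates; its length is what locates earlier results in later
    references. *)
Lemma circuit_sum_of (R : realType) s a o e w vs c : exists vs',
  (size vs').+1 = size (circuit_of e w) /\
  circuit_sum R s a vs ([seq place o g | g <- circuit_of e w] ++ c) =
  ((if beval (window s o) e then ratr w else 0) +
   circuit_sum R s a (beval (window s o) e :: vs' ++ vs) c)%R.
Proof.
elim: e w vs c => [l v|b|e IH|e1 IH1 e2 IH2] w vs c /=.
- by exists [::].
- by exists [::].
- have [vs' [sz E]] := IH 0%R vs ([:: place o (TNot 0, w)] ++ c).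
  exists (beval (window s o) e :: vs'); rewrite size_cat /= -sz addn1; split=> //.
  by rewrite map_cat -catA E rmorph0 if_same add0r.
- have [vs1 [sz1 E1]] := IH1 0%R vs
    ([seq place o g | g <- circuit_of e2 0%R ++ [:: (TAnd 0 (size (circuit_of e2 0%R)), w)]] ++ c).
  have [vs2 [sz2 E2]] := IH2 0%R (beval (window s o) e1 :: vs1 ++ vs)
    ([:: place o (TAnd 0 (size (circuit_of e2 0%R)), w)] ++ c).
  exists (beval (window s o) e2 :: vs2 ++ beval (window s o) e1 :: vs1).
  split; first by rewrite !size_cat /= -sz1 -sz2 size_cat /=; lia.
  rewrite map_cat -catA E1 rmorph0 if_same add0r map_cat -catA E2 rmorph0 if_same add0r.
  by rewrite /= -sz2 /= nth_cat ltnn subnn /= andbC -catA.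
Qed.

Definition windows_circuit (e : bexpr) (os : seq nat) : seq (gate N 4 * rat) :=
  flatten [seq [seq place o g | g <- circuit_of e (- 1)%R] | o <- os].

Lemma windows_circuit_value (R : realType) s a e os :
  circuit_value R s a (windows_circuit e os) =
  (- (count (fun o => beval (window s o) e) os)%:R)%R.
Proof.
rewrite /circuit_value /windows_circuit; move: [::].
elim: os => [|o os IH] vs /=; first by rewrite oppr0.
have [vs' [_ ->]] := circuit_sum_of R s a o e (-1)%R vs
  (flatten [seq [seq place o g | g <- circuit_of e (-1)%R] | o <- os]).
rewrite IH natrD opprD; congr (_ + _)%R.
by case: (beval _ _); rewrite ?rmorphN1 ?oppr0.
Qed.

End Place.

(** * Tilings as bandits *)

Section Bandit.
Variables (G : finType) (ok : G -> G -> G -> G -> bool).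

(* A tile is coded in unary over [ncode] bits, each bit being an arm. *)
Definition ncode : nat := #|G|.
Definition tile_bit (g : G) (l : nat) : bool := l == enum_rank g.

(* State [2 * b + c] of an arm: its bit is [c], and it was [b] one step
   before. *)
Definition codes_cur (u : nat -> 'I_4) (o : nat) (g : G) : bool :=
  all (fun l => odd (u (o + l)) == tile_bit g l) (iota 0 ncode).
Definition codes_prev (u : nat -> 'I_4) (o : nat) (g : G) : bool :=
  all (fun l => (1 < u (o + l)) == tile_bit g l) (iota 0 ncode).

(* Vacuous at time [0], where all previous bits are [false] and code no tile. *)
Definition good (u : nat -> 'I_4) : bool :=
  [forall a, forall b, codes_prev u 0 a && codes_prev u ncode b ==>
    [exists a', exists b',
      [&& codes_cur u 0 a', codes_cur u ncode b' & ok a b a' b']]].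

Definition bit_next (s : 'I_4) (c : bool) : 'I_4 := inord (2 * odd s + c).

Lemma odd_bit_next s c : odd (bit_next s c) = c.
Proof. by rewrite /bit_next inordK; case: (odd s); case: c. Qed.

Lemma prev_bit_next s c : (1 < bit_next s c) = odd s.
Proof. by rewrite /bit_next inordK; case: (odd s); case: c. Qed.

Lemma codes_inj (h : nat -> bool) a b :
  all (fun l => h l == tile_bit a l) (iota 0 ncode) ->
  all (fun l => h l == tile_bit b l) (iota 0 ncode) -> a = b.
Proof.
move=> /allP ha /allP hb; apply: enum_rank_inj; apply: val_inj => /=.
have ka : (enum_rank a : nat) \in iota 0 ncode by rewrite mem_iota /=.
have /eqP := hb _ ka; rewrite (eqP (ha _ ka)) /tile_bit eqxx => /esym/eqP.
exact.
Qed.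

Lemma good_local u u' : (forall l, l < ncode + ncode -> u l = u' l) ->
  good u = good u'.
Proof.
move=> uu'; have E o : o <= ncode ->
    codes_cur u o =1 codes_cur u' o /\ codes_prev u o =1 codes_prev u' o.
  move=> ho; split=> g; apply: eq_in_all => l; rewrite mem_iota /= => hl;
    by rewrite uu'//; lia.
have [c0 p0] := E 0 (leq0n _); have [c1 p1] := E ncode (leqnn _).
apply: eq_forallb => a; apply: eq_forallb => b; rewrite p0 p1; congr (_ ==> _).
by apply: eq_existsb => a'; apply: eq_existsb => b'; rewrite c0 c1.
Qed.

Lemma bad_expr : exists e, inputs_below (ncode + ncode) e /\
  forall u, beval u e = ~~ good u.
Proof.
by apply: bexpr_complete => u u' uu'; rewrite (good_local uu').
Qed.

Section Rows.
Variables (W : nat) (r0 : nat -> G).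
Hypothesis W1 : 1 < W.
Let N := W * ncode.
Hypothesis N0 : 0 < N.
Let ord := arm N0.

Definition init_state : joint_state N 'I_4 :=
  [ffun i : 'I_N => inord (tile_bit (r0 (i %/ ncode)) (i %% ncode))].

Let k0 : 0 < ncode. Proof. by move: N0; rewrite /N muln_gt0 => /andP[]. Qed.

Let ordE p l : p < W -> l < ncode -> ord (p * ncode + l) = p * ncode + l :> nat.
Proof.
move=> pW lk; rewrite /= modn_small// /N.
by have := leq_mul pW (leqnn ncode); rewrite mulSn; lia.
Qed.

Let ord_div p l : p < W -> l < ncode -> ord (p * ncode + l) %/ ncode = p.
Proof. by move=> pW lk; rewrite ordE// divnMDl// divn_small// addn0. Qed.

Let ord_mod p l : p < W -> l < ncode -> ord (p * ncode + l) %% ncode = l.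
Proof. by move=> pW lk; rewrite ordE// modnMDl modn_small. Qed.

Definition row_cur (s : joint_state N 'I_4) (r : nat -> G) : Prop :=
  forall p, p < W -> codes_cur (window N0 s (p * ncode)) 0 (r p).
Definition row_prev (s : joint_state N 'I_4) (r : nat -> G) : Prop :=
  forall p, p < W -> codes_prev (window N0 s (p * ncode)) 0 (r p).

Lemma window_shift s p l : window N0 s (p * ncode) (ncode + l) =
  window N0 s (p.+1 * ncode) l.
Proof. by rewrite /window addnA -mulSnr. Qed.

Lemma cur_second s p g : codes_cur (window N0 s (p * ncode)) ncode g =
  codes_cur (window N0 s (p.+1 * ncode)) 0 g.
Proof. by apply: eq_all => l; rewrite window_shift. Qed.

Lemma prev_second s p g : codes_prev (window N0 s (p * ncode)) ncode g =
  codes_prev (window N0 s (p.+1 * ncode)) 0 g.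
Proof. by apply: eq_all => l; rewrite window_shift. Qed.

Lemma next_prev pi s r : row_cur s r -> row_prev (joint_next bit_next pi s) r.
Proof.
move=> h p pW; have := h p pW; rewrite /codes_cur /codes_prev; apply: sub_all.
by move=> l; rewrite /window ffunE prev_bit_next.
Qed.

Lemma row_cur0 : row_cur init_state r0.
Proof.
move=> p pW; apply/allP => l; rewrite mem_iota add0n /= => lk.
rewrite /window ffunE -/ord ord_div// ord_mod// inordK; last by case: tile_bit.
by case: tile_bit.
Qed.

Lemma good0 p : good (window N0 init_state (p * ncode)).
Proof.
apply/forallP => a; apply/forallP => b; apply/implyP => /andP[/allP h _].
have /h : (enum_rank a : nat) \in iota 0 ncode by rewrite mem_iota /=.
have -> : tile_bit a (enum_rank a) = true by rewrite /tile_bit eqxx.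
by rewrite /window ffunE inordK; case: tile_bit.
Qed.

Definition safe (pi : policy N 'I_4) : Prop := forall t p, p.+1 < W ->
  good (window N0 (trajectory bit_next pi init_state t) (p * ncode)).

(** Tiles are read off the bits. A policy cannot escape by writing bits that code nothing: once a
    row codes tiles, its good windows force the next row to code tiles too. *)
Lemma safe_tileable pi : safe pi -> tileable ok W r0.
Proof.
move=> hs; pose h t := trajectory bit_next pi init_state t.
pose r t p := odflt (r0 p) [pick g | codes_cur (window N0 (h t) (p * ncode)) 0 g].
have rE t p g : codes_cur (window N0 (h t) (p * ncode)) 0 g -> r t p = g.
  move=> hg; rewrite /r; case: pickP => [g' hg'|/(_ g)]; last by rewrite hg.
  exact: codes_inj hg' hg.
have step t p : p.+1 < W -> row_cur (h t) (r t) ->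
    exists a' b', [/\ codes_cur (window N0 (h t.+1) (p * ncode)) 0 a',
      codes_cur (window N0 (h t.+1) (p.+1 * ncode)) 0 b' &
      ok (r t p) (r t p.+1) a' b'].
  move=> pW /(next_prev pi) hp.
  have /forallP/(_ (r t p))/forallP/(_ (r t p.+1)) := hs t.+1 p pW.
  rewrite prev_second (hp p (ltnW pW)) (hp _ pW) /= => /existsP[a' /existsP[b']].
  by rewrite cur_second => /and3P[*]; exists a', b'.
have cur t : row_cur (h t) (r t).
  elim: t => [|t IH] p pW.
    by rewrite (rE 0 p (r0 p))//; exact: row_cur0.
  case: p pW => [|p] pW.
    by have [a' [b' [ha _ _]]] := step t 0 W1 IH; rewrite (rE _ _ _ ha).
  by have [a' [b' [_ hb _]]] := step t p pW IH; rewrite (rE _ _ _ hb).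
exists r; split=> [p pW|t p pW]; first by apply: rE; exact: row_cur0.
have [a' [b' [ha hb]]] := step t p pW (cur t).
by rewrite (rE _ _ _ ha) (rE _ _ _ hb).
Qed.

(** A policy sees the joint state but not the time, so it cannot simply replay a given tiling. It
    chooses some tiling that starts with the current row and writes its second row; the invariant is
    that such a tiling exists. *)
Lemma tileable_safe : tileable ok W r0 -> exists pi, safe pi.
Proof.
move=> [r [rr0 hr]].
pose live s r := row_cur s (r 0) /\ tiling ok W r.
pose next s := xget (fun _ _ => r0 0) [set r | live s r]%classic.
pose pi : policy N 'I_4 := fun s =>
  [ffun i : 'I_N => tile_bit (next s 1 (i %/ ncode)) (i %% ncode)].
exists pi.
suff H t : (exists r, live (trajectory bit_next pi init_state t) r) /\
    forall p, p.+1 < W -> good (window N0 (trajectory bit_next pi init_state t) (p * ncode)).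
  by move=> t p; exact: (H t).2.
elim: t => [|t [[r1 hr1] _]].
  split=> [|p _]; last exact: good0.
  exists r; split=> // p pW; rewrite rr0//; exact: row_cur0.
set s := trajectory _ _ _ t in hr1 *.
have [hc ht] : live s (next s) by apply: (@xgetPex _ _ [set r | live s r]%classic); exists r1.
have cN : row_cur (joint_next bit_next pi s) (next s 1).
  move=> p pW; apply/allP => l; rewrite mem_iota add0n /= => lk.
  by rewrite /window !ffunE -/ord odd_bit_next ord_div// ord_mod.
have pN : row_prev (joint_next bit_next pi s) (next s 0) by exact: next_prev.
rewrite /trajectory iterS -/(trajectory _ _ _ _) -/s; split.
  (* Without its first row, the chosen tiling witnesses the invariant for the next state. *)
  exists (fun t => next s t.+1); split=> // t' p; exact: ht.
move=> p pW; apply/forallP => a; apply/forallP => b.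
apply/implyP; rewrite prev_second => /andP[ha hb].
rewrite (codes_inj ha (pN p (ltnW pW))) (codes_inj hb (pN _ pW)).
apply/existsP; exists (next s 1 p); apply/existsP; exists (next s 1 p.+1).
by rewrite cur_second cN 1?ltnW// cN//= ht.
Qed.

Variable e : bexpr.
Hypothesis eE : forall u, beval u e = ~~ good u.

(** The budget [N] lets a policy write any row, and the threshold [0] is an upper bound of all
    returns. *)
Definition data : rmabg_data := @RmabgData N 4 N
  [ffun=> [ffun=> [ffun=> 0%R]]]
  (windows_circuit N0 e [seq p * ncode | p <- iota 0 W.-1])
  [ffun=> [ffun s => [ffun a => [ffun s' => ((s' == bit_next s a)%:R)%R]]]]
  (2%:R^-1)%R init_state 0%R.

Lemma discount_data (R : realType) : (0 < discount (rmabg_of_data R data) < 1)%R.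
Proof.
have -> : (discount (rmabg_of_data R data) = 2%:R^-1)%R.
  by rewrite [LHS]fmorphV; congr (_^-1)%R; exact: ratr_nat.
by rewrite invr_gt0 ltr0n /= invf_lt1 ?ltr0n// ltr1n.
Qed.

Lemma reward_data (R : realType) s a :
  reward (rmabg_of_data R data) s a =
  (- (count (fun p => ~~ good (window N0 s (p * ncode))) (iota 0 W.-1))%:R)%R.
Proof.
rewrite /reward /= [X in (_ + X)%R]big1; last first.
  by move=> i _; rewrite !ffunE rmorph0.
rewrite addr0 windows_circuit_value count_map.
by congr (- _%:R)%R; apply: eq_count => p /=; rewrite eE.
Qed.

Lemma data_legal (R : realType) : legal (d := RMAB_G R) data.
Proof.
split=> //=.
- move=> i s a; split=> [s'|].
    by rewrite /= !ffunE ratr_nat ler0n.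
  rewrite (bigD1 (bit_next s a))//= big1 ?addr0 => [|s' /negbTE ne].
    by rewrite !ffunE eqxx rmorph1.
  by rewrite !ffunE ne rmorph0.
- by have /andP[/ltW -> ->] := discount_data R.
- move=> s; split=> [A B _|A B] /=; by rewrite !windows_circuit_value.
Qed.

Lemma data_yes (R : realType) :
  yes (d := RMAB_G R) data <-> tileable ok W r0.
Proof.
pose B := rmabg_of_data R data.
have tE i s a s' : arm_transition B i s a s' = ((s' == bit_next s a)%:R)%R.
  by rewrite /= !ffunE ratr_nat.
have d01 := discount_data R.
have r_le0 s a : (reward B s a <= 0)%R by rewrite reward_data oppr_le0 ler0n.
have safeP pi : (0 <= discounted_return B pi (trajectory bit_next pi init_state))%R <->
    safe pi.
  rewrite (discounted_return_ge0 d01)//; split=> H t.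
    move=> p pW; have /eqP := H t; rewrite reward_data oppr_eq0 pnatr_eq0.
    rewrite -leqn0 leqNgt -has_count => /hasPn /(_ p).
    by rewrite mem_iota negbK; apply; lia.
  rewrite reward_data; apply/eqP; rewrite oppr_eq0 pnatr_eq0 -leqn0 leqNgt -has_count.
  by apply/hasPn => p; rewrite mem_iota negbK => hp; apply: H; lia.
split=> [[pi [v [_ /(has_value_trajectory tE d01) -> ]]]|/tileable_safe[pi hpi]].
  by rewrite /= rmorph0 lee_fin => /safeP; exact: safe_tileable.
exists pi, (discounted_return B pi (trajectory bit_next pi init_state))%:E; split.
- move=> s /=; apply: (@leq_trans (\sum_(i < N) 1)%N).
    by apply: leq_sum => i _; exact: leq_b1.
  by rewrite sum1_card card_ord.
- exact/(has_value_trajectory tE d01).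
- by rewrite /= rmorph0 lee_fin; apply/safeP.
Qed.

End Rows.
End Bandit.

(** * Printing the bandit *)

Definition repeat (n : nat) (w : bitstring) : bitstring := flatten (nseq n w).

Lemma repeatD m n w : repeat (m + n) w = repeat m w ++ repeat n w.
Proof. by rewrite /repeat nseqD flatten_cat. Qed.

Lemma repeatM m n w : repeat (m * n) w = repeat m (repeat n w).
Proof.
by elim: m => // m IH; rewrite mulSn repeatD IH.
Qed.

Lemma repeat1 n (b : bool) : repeat n [:: b] = nseq n b.
Proof. by elim: n => //= n <-. Qed.

Lemma enc_unaryD m n : enc_unary (m + n) = nseq m true ++ enc_unary n.
Proof. by rewrite /enc_unary nseqD rcons_cat. Qed.

Lemma enc_unaryE n : enc_unary n = nseq n true ++ [:: false].
Proof. by rewrite /enc_unary cats1. Qed.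

Lemma enc_seqE (T : Type) (f : T -> bitstring) l :
  enc_seq f l = flatten [seq true :: f x | x <- l] ++ [:: false].
Proof. by elim: l => //= x l ->; rewrite catA. Qed.

Lemma enc_ffun_ord (T : Type) (n : nat) (f : T -> bitstring)
    (g : {ffun 'I_n -> T}) (h : nat -> bitstring) :
  (forall i : 'I_n, f (g i) = h i) ->
  enc_ffun f g = flatten [seq h i | i <- iota 0 n].
Proof.
move=> gh; rewrite /enc_ffun -val_enum_ord -map_comp; congr flatten.
exact: eq_map.
Qed.

Lemma enc_ffun_cst (T : Type) (n : nat) (f : T -> bitstring) (a : T) :
  enc_ffun f ([ffun=> a] : {ffun 'I_n -> T}) = repeat n (f a).
Proof.
rewrite (@enc_ffun_ord _ n _ _ (fun=> f a)) => [|i]; last by rewrite ffunE.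
by rewrite /repeat; elim: n (0) => //= n IH m; rewrite IH.
Qed.

Lemma flatten_columns (h : nat -> bitstring) W k :
  flatten [seq h i | i <- iota 0 (W * k)] =
  flatten [seq flatten [seq h (p * k + l) | l <- iota 0 k] | p <- iota 0 W].
Proof.
elim: W => // W IH; rewrite -[in RHS]addn1 iotaD map_cat flatten_cat -IH /= cats0.
rewrite mulSnr iotaD map_cat flatten_cat add0n; congr (_ ++ flatten _).
by rewrite -[W * k]addn0 iotaDl -map_comp; apply: eq_map => l; rewrite /= addn0.
Qed.

Lemma map_nth_default (A B : Type) (f : A -> B) (d : A) (w : seq A) m :
  [seq f (nth d w p) | p <- iota 0 (size w + m)] = map f w ++ nseq m (f d).
Proof.
rewrite iotaD map_cat; congr (_ ++ _).
  by rewrite -[in RHS](mkseq_nth d w) /mkseq -map_comp.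
have : size w <= 0 + size w by [].
elim: m (0 + size w) => //= m IH i wi; rewrite nth_default//.
by rewrite IH// leqW.
Qed.

(** Quantifying over the present content [u] of tape [j] makes this property compose along sequences
    and loops. *)
Definition emits (p : prog) (j : nat) (s : store) (w : bitstring) : Prop :=
  forall u, sem p (upd s j u) = upd s j (u ++ w).

Lemma emits_seq p q j s w w' : emits p j s w -> emits q j s w' ->
  emits (Seq p q) j s (w ++ w').
Proof. by move=> hp hq u; rewrite /= hp hq catA. Qed.

Lemma emits_for i p q j s wp wq : i != j ->
  emits p j s wp -> emits q j s wq ->
  emits (For i p q) j s (flatten [seq if c then wq else wp | c <- s i]).
Proof.
move=> ij hp hq u /=; rewrite upd_neq//.
elim: (s i) u => /= [|c w IH] u; first by rewrite cats0.
by case: c; rewrite ?hq ?hp IH catA.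
Qed.

Definition put_word (j : nat) (w : bitstring) : prog :=
  foldr (fun c p => Seq (Put j c) p) Skip w.

Lemma emits_put_word j s w : emits (put_word j w) j s w.
Proof.
elim: w => [|c w IH] u /=; first by rewrite cats0.
by rewrite upd_upd upd_eq IH cat_rcons.
Qed.

Lemma wfp_put_word E l j w : 0 < j -> j <= E -> j \notin l ->
  wfp E l (put_word j w).
Proof. by move=> j0 jE jl; elim: w => //= c w ->; rewrite j0 jE jl. Qed.

Definition for_each (i : nat) (p : prog) : prog := For i p p.

Lemma emits_for_each i p j s w : i != j -> emits p j s w ->
  emits (for_each i p) j s (repeat (size (s i)) w).
Proof.
move=> ij hp u; rewrite (emits_for ij hp hp); congr (upd _ _ (_ ++ _)).
by elim: (s i) => //= c v ->; rewrite if_same.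
Qed.

(** For each mark on tape [D'.+2], tape [D'.+3] receives two marks and one per input letter. Tape
    [D.+2] thus ends with a power of exponent [D] in unary. *)
Fixpoint powers (D : nat) : prog :=
  if D is D'.+1 then
    Seq (powers D') (for_each D'.+2 (Seq (put_word D'.+3 [:: true; true])
      (for_each 1 (put_word D'.+3 [:: true]))))
  else put_word 2 [:: true].

Definition registers (D : nat) (x : bitstring) : store := fun j =>
  if j == 1 then x else
  if 1 < j <= D.+2 then nseq ((size x).+2 ^ j.-2) true else [::].

Lemma powersE D x : sem (powers D) (upd (fun=> [::]) 1 x) = registers D x.
Proof.
elim: D => [|D IH].
  by apply: funext => -[|[|[|j]]].
pose body := Seq (put_word D.+3 [:: true; true])
  (for_each 1 (put_word D.+3 [:: true])).
rewrite (_ : sem _ _ = sem (for_each D.+2 body) (sem (powers D) (upd (fun=> [::]) 1 x)))//.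
rewrite {}IH.
have regD : registers D x D.+3 = [::] by rewrite /registers /= ltnn.
rewrite -{1}(upd_id (registers D x) D.+3) regD.
have hb : emits body D.+3 (registers D x) (nseq (size x).+2 true).
  have -> : nseq (size x).+2 true = [:: true; true] ++ repeat (size x) [:: true].
    by rewrite repeat1.
  apply: emits_seq; first exact: emits_put_word.
  by apply: (emits_for_each (i := 1)) => //; exact: emits_put_word.
rewrite (emits_for_each (negbT (ltn_eqF (ltnSn _))) hb [::]) cat0s.
have -> : repeat (size (registers D x D.+2)) (nseq (size x).+2 true) =
    nseq ((size x).+2 ^ D.+1) true.
  rewrite (_ : size _ = (size x).+2 ^ D); last first.
    by rewrite /registers /= leqnn size_nseq.
  by rewrite -[nseq (size x).+2 true]repeat1 -repeatM repeat1 expnSr.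
apply: funext => j; rewrite /upd; case: (j =P D.+3) => [->|/eqP jD].
  by rewrite /registers /= ltnSn.
by rewrite /registers (_ : (1 < j <= D.+3) = (1 < j <= D.+2))//; lia.
Qed.

Lemma wfp_powers D E : D.+2 < E -> wfp E [::] (powers D).
Proof.
elim: D => [|D IH] hE /=; first by rewrite (ltnW hE).
rewrite IH ?(ltnW hE)//= !in_cons !in_nil !andbT /=.
by repeat (apply/andP; split); lia.
Qed.

(** * The program that prints the code of the bandit *)

Section Printer.
Variables (G : finType) (first blank : G) (letter : bool -> G) (D : nat) (e : bexpr).

Let k := ncode G.
(** Tape [P] counts in unary the arms that precede the current window; tape [O] is the output. *)
Let P := D.+3.
Let O := D.+4.

Definition tile_word (g : G) : bitstring :=
  flatten [seq enc_unary (tile_bit g l) | l <- iota 0 k].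

(** The index [o + l] of an input arm is the only part of a gate that varies with the window. In
    unary it is [o] marks followed by the code of [l], so the code of a gate splits around a copy of
    tape [P]. The leading [true] comes from [enc_seq]. *)
Definition before_index (g : tgate * rat) : bitstring :=
  true :: match g.1 with
  | TIn _ _ => enc_unary 0
  | TCst b => enc_unary 2 ++ enc_bool b
  | TNot k => enc_unary 3 ++ enc_unary k
  | TAnd k l => enc_unary 4 ++ enc_unary k ++ enc_unary l
  end.

Definition after_index (g : tgate * rat) : bitstring :=
  (if g.1 is TIn l v then enc_unary l ++ enc_ord v else [::]) ++ enc_rat g.2.

Definition gate_word (o : nat) (g : tgate * rat) : bitstring :=
  before_index g ++ (if g.1 is TIn _ _ then nseq o true else [::]) ++
  after_index g.

Definition print_gate (g : tgate * rat) : prog :=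
  Seq (put_word O (before_index g))
    (Seq (if g.1 is TIn _ _ then for_each P (put_word O [:: true]) else Skip)
         (put_word O (after_index g))).

Definition window_gates := circuit_of e (- 1)%R.

(** The offset only increases, by [k] per window, so an append-only counter suffices. *)
Definition print_window : prog :=
  Seq (foldr (fun g p => Seq (print_gate g) p) Skip window_gates)
      (put_word P (nseq k true)).

(** One copy, one per input letter and one per mark of tape [D.+2] make [width D n] copies. *)
Definition print_repeat (w : bitstring) : prog :=
  Seq (put_word O w)
    (Seq (for_each 1 (put_word O w)) (for_each D.+2 (put_word O w))).

Definition reward_word : bitstring :=
  enc_ffun (enc_ffun enc_rat) ([ffun=> [ffun=> 0%R]] :
    {ffun 'I_4 -> {ffun bool -> rat}}).

Definition transition_word : bitstring :=
  enc_ffun (enc_ffun (enc_ffun enc_rat))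
    ([ffun s => [ffun a => [ffun s' => ((s' == bit_next s a)%:R)%R]]] :
    {ffun 'I_4 -> {ffun bool -> {ffun 'I_4 -> rat}}}).

Definition print_counts : prog :=
  Seq (print_repeat (nseq k true))
    (Seq (put_word O (false :: enc_unary 4))
      (Seq (print_repeat (nseq k true))
        (Seq (put_word O [:: false]) (print_repeat (repeat k reward_word))))).

Definition print_rest : prog :=
  Seq (put_word O [:: false])
    (Seq (print_repeat (repeat k transition_word))
      (Seq (put_word O (enc_rat (2%:R^-1)%R))
        (Seq (put_word O (tile_word first))
          (Seq (For 1 (put_word O (tile_word (letter false)))
                      (put_word O (tile_word (letter true))))
            (Seq (for_each D.+2 (put_word O (tile_word blank)))
              (put_word O (enc_rat 0%R))))))).

Definition printer : prog :=
  Seq (powers D)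
    (Seq print_counts
      (Seq (Seq (for_each 1 print_window) (for_each D.+2 print_window))
        print_rest)).

Lemma wfp_printer : wfp O [::] printer.
Proof.
have seqP l p q : wfp O l p -> wfp O l q -> wfp O l (Seq p q).
  by move=> /= -> ->.
have forP l i p q : 0 < i <= P -> i \notin l -> wfp O (i :: l) p ->
    wfp O (i :: l) q -> wfp O l (For i p q).
  by move=> /andP[i0 iP] /= -> -> ->; rewrite i0 ltnS iP.
have put l w : O \notin l -> wfp O l (put_word O w).
  by move=> hl; apply: wfp_put_word.
have out i : i <= P -> O \notin [:: i] by rewrite inE; lia.
have R : 0 < D.+2 <= P by rewrite leqnSn.
have rep w : wfp O [::] (print_repeat w).
  apply: (seqP); first exact: put.
  by apply: (seqP); apply: forP => //; apply: put; apply: out; rewrite ?leqnSn.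
have win i : i <= D.+2 -> wfp O [:: i] print_window.
  move=> iR; have iP : i <= P by exact: leqW.
  apply: (seqP); last by apply: wfp_put_word; rewrite ?leqnSn ?inE//; lia.
  elim: window_gates => // g gs IH; apply: (seqP) => //.
  apply: (seqP); first by apply: put; exact: out.
  apply: (seqP); last by apply: put; exact: out.
  case: (g.1) => // _ _; rewrite /for_each.
  have hP : P \notin [:: i] by rewrite inE; lia.
  have hO : O \notin [:: P; i] by rewrite !inE; lia.
  by apply: forP; rewrite ?leqnn //; exact: put.
apply: (seqP); first exact: wfp_powers.
apply: (seqP); first by repeat first [exact: rep | exact: put | apply: (seqP)].
apply: (seqP); first by apply: (seqP); apply: forP => //; exact: win.
apply: (seqP); first exact: put.
apply: (seqP); first exact: rep.
apply: (seqP); first exact: put.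
apply: (seqP); first exact: put.
apply: (seqP); first by apply: forP => //; apply: put; exact: out.
apply: (seqP); last exact: put.
by apply: forP => //; apply: put; apply: out; rewrite leqnSn.
Qed.

Section Run.
Variables (x : bitstring).
Let W := width D (size x).

Variable s : store.
Hypotheses (s1 : s 1 = x) (sR : s D.+2 = nseq ((size x).+2 ^ D) true).

Lemma emits_repeat j u w : j != 1 -> j != D.+2 ->
  emits (print_repeat w) O (upd s j u) (repeat W w).
Proof.
move=> j1 jD; have -> : repeat W w = w ++ repeat (size (upd s j u 1)) w ++
    repeat (size (upd s j u D.+2)) w.
  rewrite /W /width !upd_neq 1?eq_sym// s1 sR size_nseq -repeatD.
  by rewrite -add1n repeatD {1}/repeat /= cats0.
do ![apply: emits_seq]; first exact: emits_put_word.
  by apply: emits_for_each => //; exact: emits_put_word.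
by apply: emits_for_each; [rewrite /O; lia|exact: emits_put_word].
Qed.

Lemma emits_gate o g : emits (print_gate g) O (upd s P (nseq o true)) (gate_word o g).
Proof.
apply: emits_seq; first exact: emits_put_word.
apply: emits_seq; last exact: emits_put_word.
case: (g.1) => [l v|b|i|i j]; try by move=> u; rewrite cats0.
have := @emits_for_each P (put_word O [:: true]) O (upd s P (nseq o true)) [:: true].
rewrite upd_eq size_nseq repeat1; apply; first by rewrite neq_ltn ltnSn.
exact: emits_put_word.
Qed.

Definition window_word (o : nat) : bitstring :=
  flatten [seq gate_word o g | g <- window_gates].

Lemma sem_window o u :
  sem print_window (upd (upd s P (nseq o true)) O u) =
  upd (upd s P (nseq (o + k) true)) O (u ++ window_word o).
Proof.
have PO : P != O by rewrite neq_ltn ltnSn.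
rewrite [LHS](_ : _ = sem (put_word P (nseq k true))
  (sem (foldr (fun g p => Seq (print_gate g) p) Skip window_gates)
    (upd (upd s P (nseq o true)) O u)))//.
have -> : sem (foldr (fun g p => Seq (print_gate g) p) Skip window_gates)
    (upd (upd s P (nseq o true)) O u) =
    upd (upd s P (nseq o true)) O (u ++ window_word o).
  rewrite /window_word; elim: window_gates u => [|g gs IH] u; first by rewrite /= cats0.
  rewrite [LHS](_ : _ = sem (foldr (fun g p => Seq (print_gate g) p) Skip gs)
    (sem (print_gate g) (upd (upd s P (nseq o true)) O u)))//.
  by rewrite (emits_gate o g u) IH -catA.
rewrite updC// (emits_put_word P _ _ (nseq o true)) -nseqD.
by rewrite updC// eq_sym.
Qed.

Lemma sem_windows p n u i : size (s i) = n -> i != P -> i != O ->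
  sem (for_each i print_window) (upd (upd s P (nseq (p * k) true)) O u) =
  upd (upd s P (nseq ((p + n) * k) true)) O
    (u ++ flatten [seq window_word (q * k) | q <- iota p n]).
Proof.
move=> <- iP iO; rewrite [LHS]/= !upd_neq//.
elim: (s i) p u => [|c w IH] p u; first by rewrite /= addn0 cats0.
rewrite [foldl _ _ _]/= if_same sem_window -mulSnr IH /= addSnnS catA.
by [].
Qed.

End Run.

Section Code.
Variable x : bitstring.
Let W := width D (size x).
Let N := W * k.
Let r0 := nth blank (first :: map letter x).
Let S := (size x).+2 ^ D.

Definition counts_word : bitstring :=
  repeat W (nseq k true) ++ (false :: enc_unary 4) ++
  repeat W (nseq k true) ++ [:: false] ++ repeat W (repeat k reward_word).

Definition rest_word : bitstring :=
  [:: false] ++ repeat W (repeat k transition_word) ++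
  enc_rat (2%:R^-1)%R ++ tile_word first ++
  flatten [seq if c then tile_word (letter true) else tile_word (letter false)
          | c <- x] ++
  repeat S (tile_word blank) ++ enc_rat 0%R.

Lemma sem_printer : sem printer (upd (fun=> [::]) 1 x) =
  upd (upd (registers D x) P (nseq (W.-1 * k) true)) O
    (counts_word ++ flatten [seq window_word (q * k) | q <- iota 0 W.-1] ++
     rest_word).
Proof.
set s := registers D x.
have s1 : s 1 = x by [].
have sR : s D.+2 = nseq S true by rewrite /s /registers /= leqnn.
have sP : s P = [::] by rewrite /s /registers /= ltnn.
have sO : s O = [::].
  by rewrite /s /registers /=; case: ltnP => //; rewrite /O; lia.
have RP : D.+2 != P by rewrite /P; lia.
have RO : D.+2 != O by rewrite /O; lia.
have PO : P != O by rewrite /P /O; lia.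
have counts u : emits print_counts O (upd s P u) counts_word.
  have rep w : emits (print_repeat w) O (upd s P u) (repeat W w).
    by apply: emits_repeat; rewrite // eq_sym.
  apply: emits_seq; first exact: rep.
  apply: emits_seq; first exact: emits_put_word.
  apply: emits_seq; first exact: rep.
  by apply: emits_seq; [exact: emits_put_word|exact: rep].
have rest u : emits print_rest O (upd s P u) rest_word.
  have rep w : emits (print_repeat w) O (upd s P u) (repeat W w).
    by apply: emits_repeat; rewrite // eq_sym.
  apply: emits_seq; first exact: emits_put_word.
  apply: emits_seq; first exact: rep.
  apply: emits_seq; first exact: emits_put_word.
  apply: emits_seq; first exact: emits_put_word.
  apply: emits_seq.
    by apply: (@emits_for 1 _ _ O (upd s P u)) => //; exact: emits_put_word.
  apply: emits_seq; last exact: emits_put_word.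
  have := @emits_for_each D.+2 (put_word O (tile_word blank)) O (upd s P u)
    (tile_word blank) RO.
  by rewrite upd_neq// sR size_nseq; apply; exact: emits_put_word.
rewrite [LHS](_ : _ = sem print_rest
  (sem (for_each D.+2 print_window) (sem (for_each 1 print_window)
    (sem print_counts (sem (powers D) (upd (fun=> [::]) 1 x))))))//.
rewrite powersE -/s.
(* The empty tapes [P] and [O] are made explicit, as offset [0 * k] and empty output, to fit the
   form of [emits] and [sem_windows]. *)
rewrite [X in sem print_counts X](_ : s = upd (upd s P (nseq (0 * k) true)) O [::]);
  last by rewrite mul0n -[nseq 0 true]sP upd_id -sO upd_id.
rewrite counts cat0s (sem_windows 0 _ (n := size x))//.
rewrite (sem_windows (0 + size x) _ (n := S))//; last by rewrite sR size_nseq.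
rewrite rest add0n -[W.-1]/(size x + S) iotaD map_cat flatten_cat add0n.
move: counts_word rest_word (flatten _) (flatten _) => c r u v.
by rewrite !catA.
Qed.

Hypothesis N0 : 0 < N.
Hypothesis e_below : inputs_below (ncode G + ncode G) e.

(** The window at [p] ends within the [N] arms, so the reduction modulo [N] in [arm] has no
    effect. *)
Lemma place_word p g : p.+1 < W ->
  (if g.1 is TIn l _ then l < k + k else true) ->
  true :: enc_weighted_gate (place N0 (p * k) g) = gate_word (p * k) g.
Proof.
move=> pW; case: g => -[l v|b|i|i j] w hl;
  rewrite /enc_weighted_gate /gate_word /before_index /after_index /= ?cats0//.
congr (_ :: _ :: _); rewrite /enc_ord /= modn_small ?enc_unaryD -?catA//.
have := leq_mul pW (leqnn k); rewrite -/k /N !mulSn; move: hl => /=; lia.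
Qed.

Lemma gates_below w : all (fun g : tgate * rat => if g.1 is TIn l _ then l < k + k else true)
  (circuit_of e w).
Proof.
move: e_below w; elim: (e) => [l v|b|e1 IH|e1 IH1 e2 IH2] /=.
- by move=> ->.
- by [].
- by move=> h w; rewrite all_cat IH.
- by move=> /andP[h1 h2] w; rewrite !all_cat IH1// IH2.
Qed.

Lemma enc_data : enc_rmabg (data r0 N0 e) =
  counts_word ++ flatten [seq window_word (q * k) | q <- iota 0 W.-1] ++
  rest_word.
Proof.
have repN w : repeat N w = repeat W (repeat k w) by rewrite repeatM.
rewrite /enc_rmabg /=.
have -> : enc_unary (W * ncode G) = repeat W (nseq k true) ++ [:: false].
  by rewrite enc_unaryE -(repeat1 (W * _)) repeatM repeat1.
rewrite !(@enc_ffun_cst _ N) !repN -/reward_word -/transition_word.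
rewrite enc_seqE.
have -> : flatten [seq true :: enc_weighted_gate x0
    | x0 <- windows_circuit N0 e [seq p * ncode G | p <- iota 0 W.-1]] =
    flatten [seq window_word (q * k) | q <- iota 0 W.-1].
  have : all (fun p => p.+1 < W) (iota 0 W.-1).
    by apply/allP => p; rewrite mem_iota /W /width /=; lia.
  rewrite /windows_circuit; elim: (iota _ _) => // p ps IH /andP[pW /IH {}IH].
  rewrite !map_cons /= map_cat flatten_cat {}IH; congr (_ ++ _).
  rewrite -map_comp; congr flatten; move: (gates_below (- 1)%R).
  rewrite /window_gates; elim: (circuit_of _ _) => // g gs IHg /andP[hg /IHg IH'].
  by rewrite !map_cons IH' /= place_word.
have -> : enc_ffun (@enc_ord _) (init_state W r0) = tile_word first ++
  flatten [seq if c then tile_word (letter true) else tile_word (letter false)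
          | c <- x] ++ repeat S (tile_word blank).
  rewrite (@enc_ffun_ord _ _ _ _ (fun i => enc_unary (tile_bit (r0 (i %/ k)) (i %% k)))).
    rewrite flatten_columns (_ : W = size (first :: map letter x) + S); last first.
      by rewrite /= size_map.
    rewrite [X in flatten X = _](_ : _ = [seq tile_word (r0 p)
        | p <- iota 0 (size (first :: map letter x) + S)]); last first.
      apply: eq_map => p; congr flatten; apply/eq_in_map => l.
      rewrite mem_iota add0n => /andP[_ lk].
      have k0 : 0 < k by apply: leq_ltn_trans lk.
      by rewrite divnMDl// modnMDl divn_small// modn_small// addn0.
    rewrite map_nth_default flatten_cat /= -catA -map_comp; congr (_ ++ (_ ++ _)).
    by congr flatten; apply: eq_map => -[].
  move=> i; rewrite ffunE /enc_ord inordK//.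
  by case: tile_bit.
by rewrite /counts_word /rest_word -!catA.
Qed.

End Code.
End Printer.

(** * The reduction from an arbitrary language in polynomial space *)

Theorem theorem1 (R : realType) : PSPACE_hard (RMAB_G R).
Proof.
move=> L /PSPACE_tileable[G [ok [first [blank [letter [D HL]]]]]].
(* [e] is chosen before the input [x], so the printer is one fixed program. *)
have [e [e_below eE]] := bad_expr ok.
have N0 (x : bitstring) : 0 < width D (size x) * ncode G.
  by rewrite muln_gt0 /=; apply/card_gt0P; exists first.
exists (fun x => data (nth blank (first :: map letter x)) (N0 x) e); split.
  (* The summands bound the copy of the input, the unary powers and the final offset on tape [P]. *)
  pose B n := n + n.+2 ^ D + (n + n.+2 ^ D) * ncode G.
  apply: (@prog_polytime D.+4 (printer first blank letter D e) _ B) => //.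
  - exact: wfp_printer.
  - have pD : poly_bounded (fun n => n + n.+2 ^ D).
      apply: poly_boundedD; first exact: poly_bounded_id.
      by apply/poly_boundedP; exists D.
    apply: poly_boundedD => //; apply: poly_boundedM => //.
    exact: poly_bounded_cst.
  - move=> x; rewrite sem_printer; split; first by rewrite upd_eq; exact/esym/enc_data.
    move=> j jD; rewrite upd_neq; last by lia.
    rewrite /upd /B; case: eqP => [_|_].
      by rewrite size_nseq leq_addl.
    rewrite /registers; case: eqP => [_|_]; first by lia.
    case: ifP => // /andP[j1 jD2]; rewrite size_nseq.
    have : (size x).+2 ^ j.-2 <= (size x).+2 ^ D by rewrite leq_exp2l//; lia.
    lia.
move=> x; split; first exact: data_legal.
rewrite HL; apply: iff_sym; apply: data_yes => //.
by rewrite /width ltnS addn_gt0 expn_gt0 orbT.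
Qed.
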